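(* Let $\Lambda$ be an aperiodic single-vertex (row-finite, source-free) $k$-graph. Then the action $\phi$ of $\Lambda_{\mathrm{ht}}$ on $\Lambda^\infty$ is an extreme boundary action.
   Context: **$k$-graphs.** $\mathbb{N}$ includes $0$ and $k\ge 1$. A $k$-graph is a countable small category $\Lambda$ with a functor $d:\Lambda\to\mathbb{N}^k$ such that whenever $d(\mu)=n+m$ there are unique $\alpha,\beta\in\Lambda$ with $\mu=\alpha\beta$, $d(\alpha)=n$, $d(\beta)=m$, $s(\alpha)=r(\beta)$ (products $\mu\nu$ are defined when $s(\mu)=r(\nu)$). $\Lambda^n:=d^{-1}(n)$; $\Lambda^0$ is the set of vertices; $v\Lambda^n:=\{\mu\in\Lambda^n: r(\mu)=v\}$. $\Lambda$ is row-finite if all $|v\Lambda^n|<\infty$, source-free if all $v\Lambda^n\neq\varnothing$, and single-vertex if $|\Lambda^0|=1$. **Infinite paths.** $\Omega_k:=\{(p,q)\in\mathbb{N}^k\times\mathbb{N}^k: p\le q\}$ is a $k$-graph with $(p,q)(q,m)=(p,m)$, $r(p,q)=(p,p)$, $s(p,q)=(q,q)$, $d(p,q)=q-p$. $\Lambda^\infty$ is the set of degree-preserving functors $x:\Omega_k\to\Lambda$; $v\Lambda^\infty:=\{x\in\Lambda^\infty:x(0,0)=v\}$. If $s(\mu)=x(0,0)$, $\mu x$ is the infinite path obtained by prefixing $\mu$ to $x$. $Z(\mu):=\{\mu x: x\in s(\mu)\Lambda^\infty\}$, and the sets $Z(\mu)$ form a basis of the topology of $\Lambda^\infty$. $\Lambda$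 is aperiodic if for each $v\in\Lambda^0$ there is $x\in v\Lambda^\infty$ with $\sigma^m(x)\ne\sigma^n(x)$ for all $m\neq n$ in $\mathbb{N}^k$, where $\sigma^n(x)(p,q)=x(p+n,q+n)$. **The C*-algebra and $\Lambda_{\mathrm{ht}}$.** $\mathcal{O}_\Lambda$ is the universal C*-algebra generated by partial isometries $\{s_\mu\}_{\mu\in\Lambda}$ such that: $\{s_v\}_{v\in\Lambda^0}$ are mutually orthogonal projections; $s_{\mu\nu}=s_\mu s_\nu$ if $s(\mu)=r(\nu)$; $s_\mu^*s_\mu=s_{s(\mu)}$; $s_v=\sum_{\mu\in v\Lambda^n}s_\mu s_\mu^*$ for all $v\in\Lambda^0$, $n\in\mathbb{N}^k$. It is unital since $\Lambda^0$ is finite. $\Lambda_{\mathrm{ht}}$ (the Higman-Thompson like group) is the group (under multiplication) of all unitaries $U\in\mathcal{O}_\Lambda$ which can be written as a finite sum $U=\sum_{i=1}^n s_{\alpha_i}s_{\beta_i}^*$ with $\alpha_i,\beta_i\in\Lambda$, $s(\alpha_i)=s(\beta_i)$. **Action $\phi$.** For such $U$, the sets $Z(\beta_i)$ partition $\Lambda^\infty$, as do the sets $Z(\alpha_i)$. $\phi(U)(\beta_iy)=\alpha_iy$ for $y\in s(\beta_i)\Lambda^\infty$ defines an action of $\Lambda_{\mathrm{ht}}$ on $\Lambda^\infty$ by homeomorphisms (induced by the left regular representation on $\ell^2(\Lambda^\infty)$). **Extreme boundary action.** An action of a group $G$ by homeomorphisms on a space $X$ is an extreme boundary action if $X$ is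 compact and the action is minimal (every orbit is dense) and extremely proximal. A closed set $C\subseteq X$ is compressible if there is $x\in X$ such that for every neighbourhood $N$ of $x$ there is $g\in G$ with $g(C)\subseteq N$; the action is extremely proximal if every closed $C\subsetneq X$ is compressible. *)

(* Defs.v *)
From HB Require Import structures.
From mathcomp Require Import all_boot all_order all_algebra.
From mathcomp Require Import complex.
From mathcomp Require Import all_classical all_reals all_analysis.

Set Implicit Arguments.
Unset Strict Implicit.
Unset Printing Implicit Defensive.

Import Order.TTheory GRing.Theory Num.Theory.
Import numFieldNormedType.Exports.

Local Open Scope classical_set_scope.
Local Open Scope ring_scope.

(** ** The monoid N^k; addition and 0 are the pointwise ones of [{ffun _}] *)

Definition Nk (k : nat) := {ffun 'I_k -> nat}.

Definition leNk (k : nat) (p q : Nk k) : bool := [forall i, (p i <= q i)%N].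
Definition subNk (k : nat) (q p : Nk k) : Nk k := [ffun i => (q i - p i)%N].
Definition maxNk (k : nat) (p q : Nk k) : Nk k := [ffun i => maxn (p i) (q i)].

Section NkTheory.
Variable k : nat.
Implicit Types p q m n : Nk k.

Lemma leNkP p q : reflect (forall i, (p i <= q i)%N) (leNk p q).
Proof. exact: forallP. Qed.

Lemma leNkk p : leNk p p.
Proof. by apply/leNkP. Qed.

Lemma leNk_trans q p m : leNk p q -> leNk q m -> leNk p m.
Proof.
by move=> /leNkP pq /leNkP qm; apply/leNkP => i; exact: leq_trans (pq i) (qm i).
Qed.

Lemma le0Nk p : leNk 0 p.
Proof. by apply/leNkP => i; rewrite ffunE. Qed.

Lemma leNk_addr p n : leNk p (p + n).
Proof. by apply/leNkP => i; rewrite ffunE; apply: leq_addr. Qed.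

Lemma leNk_addl p n : leNk p (n + p).
Proof. by rewrite addrC leNk_addr. Qed.

Lemma leNk_add p q n : leNk p q -> leNk (p + n) (q + n).
Proof. by move=> /leNkP pq; apply/leNkP => i; rewrite !ffunE leq_add2r. Qed.

Lemma subNkK p q : leNk p q -> p + subNk q p = q.
Proof.
by move=> /leNkP pq; apply/ffunP => i; rewrite !ffunE; apply: subnKC.
Qed.

Lemma addNkI p : injective (+%R p).
Proof.
by move=> m n e; apply/ffunP => i; move/ffunP/(_ i): e; rewrite !ffunE => /addnI.
Qed.

Lemma subNk_add p q n : subNk (q + n) (p + n) = subNk q p.
Proof. by apply/ffunP => i; rewrite !ffunE; apply: subnDr. Qed.

Lemma subNk0 q : subNk q 0 = q.
Proof. by apply/ffunP => i; rewrite !ffunE; apply: subn0. Qed.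

Lemma subNkk q : subNk q q = 0.
Proof. by apply/ffunP => i; rewrite !ffunE; apply: subnn. Qed.

Lemma addNk_sub p q m : leNk p q -> leNk q m ->
  subNk m p = subNk q p + subNk m q.
Proof.
move=> pq qm; apply: (@addNkI p).
by rewrite addrA !subNkK //; exact: leNk_trans pq qm.
Qed.

End NkTheory.

(** ** k-graphs *)

(** A small category is given by its morphisms: objects are identified with
    their identity morphisms, so [rng] and [src] take values in morphisms.
    [cmp mu nu] (the product "mu nu") is only meaningful if [src mu = rng nu].
    The [countType] structure expresses countability of the category. *)
Record kgraph (k : nat) := KGraph {
  kg_mor :> countType;
  rng : kg_mor -> kg_mor;
  src : kg_mor -> kg_mor;
  cmp : kg_mor -> kg_mor -> kg_mor;
  deg : kg_mor -> Nk k;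
  rng_rng : forall mu, rng (rng mu) = rng mu;
  rng_src : forall mu, rng (src mu) = src mu;
  src_rng : forall mu, src (rng mu) = rng mu;
  src_src : forall mu, src (src mu) = src mu;
  cmp_rng : forall mu, cmp (rng mu) mu = mu;
  cmp_src : forall mu, cmp mu (src mu) = mu;
  rng_cmp : forall mu nu, src mu = rng nu -> rng (cmp mu nu) = rng mu;
  src_cmp : forall mu nu, src mu = rng nu -> src (cmp mu nu) = src nu;
  cmpA : forall mu nu la, src mu = rng nu -> src nu = rng la ->
    cmp mu (cmp nu la) = cmp (cmp mu nu) la;
  deg_rng : forall mu, deg (rng mu) = 0;
  deg_src : forall mu, deg (src mu) = 0;
  deg_cmp : forall mu nu, src mu = rng nu ->
    deg (cmp mu nu) = deg mu + deg nu;
  kg_fact : forall mu n m, deg mu = n + m ->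
    exists! ab : kg_mor * kg_mor,
      [/\ mu = cmp ab.1 ab.2, deg ab.1 = n, deg ab.2 = m & src ab.1 = rng ab.2]
}.

Arguments rng {k L} : rename.
Arguments src {k L} : rename.
Arguments cmp {k L} : rename.
Arguments deg {k L} : rename.

Definition paths (k : nat) (L : kgraph k) (n : Nk k) : set L :=
  [set mu | deg mu = n].
Arguments paths {k} L n.

Definition paths_from (k : nat) (L : kgraph k) (v : L) (n : Nk k) : set L :=
  [set mu | rng mu = v /\ deg mu = n].

(** [paths L 0] is the set of vertices: by unique factorisation a morphism of
    degree 0 is an identity. *)
Definition row_finite (k : nat) (L : kgraph k) : Prop :=
  forall (v : L) (n : Nk k), paths L 0 v -> finite_set (paths_from v n).

Definition source_free (k : nat) (L : kgraph k) : Prop :=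
  forall (v : L) (n : Nk k), paths L 0 v -> paths_from v n !=set0.

Definition single_vertex (k : nat) (L : kgraph k) : Prop :=
  exists v : L, paths L 0 = [set v].

Lemma kg_inj (k : nat) (L : kgraph k) (a b a' b' : L) :
  src a = rng b -> src a' = rng b' -> cmp a b = cmp a' b' ->
  deg a = deg a' -> a = a' /\ b = b'.
Proof.
move=> ab ab' e da.
have db : deg b = deg b'.
  by apply: (@addNkI _ (deg a)); rewrite -(deg_cmp ab) e (deg_cmp ab') da.
have [uv [_ H]] := kg_fact (deg_cmp ab).
have e1 : uv = (a, b) by apply: H.
have e2 : uv = (a', b') by apply: H.
by move: e1; rewrite e2 => -[-> ->].
Qed.

Lemma deg0_src (k : nat) (L : kgraph k) (v : L) : deg v = 0 -> src v = v.
Proof.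
move=> dv; have := @kg_inj k L (rng v) v v (src v).
rewrite src_rng rng_src cmp_rng cmp_src deg_rng dv.
by case/(_ erefl erefl erefl erefl).
Qed.

Lemma deg0_rng (k : nat) (L : kgraph k) (v : L) : deg v = 0 -> rng v = v.
Proof. by move=> /deg0_src <-; rewrite rng_src. Qed.

(** ** The k-graph Omega_k *)

Section Omega.
Variable k : nat.

Definition omega_mor := {pq : Nk k * Nk k | leNk pq.1 pq.2}.

Lemma om00_subproof : leNk (0 : Nk k, 0 : Nk k).1 (0 : Nk k, 0 : Nk k).2.
Proof. exact: leNkk. Qed.

(** The morphism (p, q); only meaningful if [leNk p q]. *)
Definition om (p q : Nk k) : omega_mor :=
  insubd (exist _ (0, 0) om00_subproof : omega_mor) (p, q).

Lemma omK p q : leNk p q -> val (om p q) = (p, q).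
Proof. by move=> pq; rewrite /om val_insubd /= pq. Qed.

Lemma om_val (a : omega_mor) : om (val a).1 (val a).2 = a.
Proof.
by apply: val_inj; rewrite omK -?surjective_pairing //; exact: (valP a).
Qed.

Lemma omP (P : omega_mor -> Prop) :
  (forall p q, leNk p q -> P (om p q)) -> forall a, P a.
Proof. by move=> H a; rewrite -(om_val a); apply: H; exact: (valP a). Qed.

Definition om_rng (a : omega_mor) : omega_mor := om (val a).1 (val a).1.
Definition om_src (a : omega_mor) : omega_mor := om (val a).2 (val a).2.
Definition om_cmp (a b : omega_mor) : omega_mor := om (val a).1 (val b).2.
Definition om_deg (a : omega_mor) : Nk k := subNk (val a).2 (val a).1.

Lemma om_inj p q p' q' : leNk p q -> leNk p' q' -> om p q = om p' q' ->
  p = p' /\ q = q'.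
Proof.
by move=> h h' /(congr1 val); rewrite !omK // => -[-> ->].
Qed.

Lemma om_comp (a b : omega_mor) : om_src a = om_rng b -> (val a).2 = (val b).1.
Proof. by move=> /(om_inj (leNkk _) (leNkk _)) []. Qed.

Lemma om_rng_rng a : om_rng (om_rng a) = om_rng a.
Proof. by rewrite /om_rng omK ?leNkk. Qed.
Lemma om_rng_src a : om_rng (om_src a) = om_src a.
Proof. by rewrite /om_rng /om_src omK ?leNkk. Qed.
Lemma om_src_rng a : om_src (om_rng a) = om_rng a.
Proof. by rewrite /om_rng /om_src omK ?leNkk. Qed.
Lemma om_src_src a : om_src (om_src a) = om_src a.
Proof. by rewrite /om_src omK ?leNkk. Qed.
Lemma om_cmp_rng a : om_cmp (om_rng a) a = a.
Proof. by rewrite /om_cmp omK ?leNkk //= om_val. Qed.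
Lemma om_cmp_src a : om_cmp a (om_src a) = a.
Proof. by rewrite /om_cmp omK ?leNkk //= om_val. Qed.

Lemma om_cmp_val a b : om_src a = om_rng b ->
  val (om_cmp a b) = ((val a).1, (val b).2).
Proof.
move=> /om_comp ab; rewrite omK //.
by apply: leNk_trans (valP a) _; rewrite ab; exact: (valP b).
Qed.

Lemma om_rng_cmp a b : om_src a = om_rng b -> om_rng (om_cmp a b) = om_rng a.
Proof. by move=> ab; rewrite /om_rng om_cmp_val. Qed.
Lemma om_src_cmp a b : om_src a = om_rng b -> om_src (om_cmp a b) = om_src b.
Proof. by move=> ab; rewrite /om_src om_cmp_val. Qed.
Lemma om_cmpA a b c : om_src a = om_rng b -> om_src b = om_rng c ->
  om_cmp a (om_cmp b c) = om_cmp (om_cmp a b) c.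
Proof. by move=> ab bc; rewrite {1}/om_cmp om_cmp_val // /om_cmp om_cmp_val. Qed.
Lemma om_deg_rng a : om_deg (om_rng a) = 0.
Proof. by rewrite /om_deg omK ?leNkk //= subNkk. Qed.
Lemma om_deg_src a : om_deg (om_src a) = 0.
Proof. by rewrite /om_deg omK ?leNkk //= subNkk. Qed.
Lemma om_deg_cmp a b : om_src a = om_rng b ->
  om_deg (om_cmp a b) = om_deg a + om_deg b.
Proof.
move=> ab; rewrite /om_deg om_cmp_val //= (@addNk_sub _ _ (val a).2).
- by rewrite (om_comp ab).
- exact: (valP a).
- by rewrite (om_comp ab); exact: (valP b).
Qed.

Lemma om_fact (a : omega_mor) (n m : Nk k) : om_deg a = n + m ->
  exists! bc : omega_mor * omega_mor,
    [/\ a = om_cmp bc.1 bc.2, om_deg bc.1 = n, om_deg bc.2 = m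
      & om_src bc.1 = om_rng bc.2].
Proof.
elim/omP: a => p q pq; rewrite /om_deg omK //= => e.
have qE : q = p + n + m by rewrite -addrA -e subNkK.
have h1 : leNk p (p + n) := leNk_addr _ _.
have h2 : leNk (p + n) q by rewrite qE leNk_addr.
exists (om p (p + n), om (p + n) q); split.
  rewrite /om_cmp /om_src /om_rng !omK //=; split => //.
    by apply: (@addNkI _ p); rewrite subNkK.
  by apply: (@addNkI _ (p + n)); rewrite subNkK.
move=> [b c] /= [].
elim/omP: b => p1 q1 h3; elim/omP: c => p2 q2 h4.
rewrite /om_cmp /om_src /om_rng !omK //= => ea d1 d2.
move=> /(om_inj (leNkk _) (leNkk _)) [eq1 _]; subst p2.
have [ep eq] := om_inj pq (leNk_trans h3 h4) ea; subst p1 q2.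
by have -> : q1 = p + n by rewrite -d1 subNkK.
Qed.

Definition Omega : kgraph k :=
  @KGraph k omega_mor om_rng om_src om_cmp om_deg
    om_rng_rng om_rng_src om_src_rng om_src_src om_cmp_rng om_cmp_src
    om_rng_cmp om_src_cmp om_cmpA om_deg_rng om_deg_src om_deg_cmp om_fact.

End Omega.

(** ** Infinite paths *)

Definition kg_functor (k : nat) (L M : kgraph k) (f : L -> M) : Prop :=
  [/\ forall a, rng (f a) = f (rng a),
      forall a, src (f a) = f (src a),
      forall a b, src a = rng b -> f (cmp a b) = cmp (f a) (f b)
    & forall a, deg (f a) = deg a].

Record ipath (k : nat) (L : kgraph k) := IPath {
  ip_fun :> Omega k -> L;
  ip_functor : kg_functor ip_fun
}.

HB.instance Definition _ (k : nat) (L : kgraph k) := gen_eqMixin (ipath L).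
HB.instance Definition _ (k : nat) (L : kgraph k) := gen_choiceMixin (ipath L).

(** The evaluation x(p,q). *)
Notation ip x p q := (ip_fun x (om p q)).

Section Paths.
Variables (k : nat) (L : kgraph k).
Implicit Types (x y z : ipath L) (mu nu : L) (p q m n : Nk k).

Lemma ip_eq x y : (forall p q, leNk p q -> ip x p q = ip y p q) -> x = y.
Proof.
move=> H; case: x y H => [f hf] [g hg] /= H.
have e : f = g by apply/funext; elim/omP => p q; exact: H.
by subst g; congr IPath; exact: Prop_irrelevance.
Qed.

Lemma ip_rng x p q : leNk p q -> rng (ip x p q) = ip x p p.
Proof.
by move=> h; case: (ip_functor x) => -> _ _ _; rewrite /= /om_rng omK.
Qed.

Lemma ip_src x p q : leNk p q -> src (ip x p q) = ip x q q.
Proof.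
by move=> h; case: (ip_functor x) => _ -> _ _; rewrite /= /om_src omK.
Qed.

Lemma ip_deg x p q : leNk p q -> deg (ip x p q) = subNk q p.
Proof.
by move=> h; case: (ip_functor x) => _ _ _ ->; rewrite /= /om_deg omK.
Qed.

Lemma ip_cmp x p q m : leNk p q -> leNk q m ->
  ip x p m = cmp (ip x p q) (ip x q m).
Proof.
move=> h h'; case: (ip_functor x) => _ _ xM _.
have c : om_src (om p q) = om_rng (om q m) by rewrite /om_src /om_rng !omK.
by have := xM _ _ c; rewrite /= {1}/om_cmp !omK.
Qed.

Definition shift_fun n x : Omega k -> L :=
  fun a => ip x ((val a).1 + n) ((val a).2 + n).

Lemma shift_funE n x p q : leNk p q ->
  shift_fun n x (om p q) = ip x (p + n) (q + n).
Proof. by move=> h; rewrite /shift_fun omK. Qed.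

Lemma shift_functor n x : kg_functor (shift_fun n x).
Proof.
split.
- elim/omP => p q h; rewrite shift_funE // ip_rng ?leNk_add //.
  by rewrite /= /om_rng omK // shift_funE ?leNkk.
- elim/omP => p q h; rewrite shift_funE // ip_src ?leNk_add //.
  by rewrite /= /om_src omK // shift_funE ?leNkk.
- elim/omP => p q h; elim/omP => q' m h'.
  rewrite /= /om_src /om_rng /om_cmp !omK //=.
  move=> /(om_inj (leNkk _) (leNkk _)) [e _]; subst q'.
  rewrite !shift_funE ?(leNk_trans h h') //.
  by apply: ip_cmp; exact: leNk_add.
- elim/omP => p q h; rewrite shift_funE // ip_deg ?leNk_add //.
  by rewrite subNk_add /= /om_deg omK.
Qed.

Definition shift n x : ipath L := IPath (shift_functor n x).

Lemma shiftE n x p q : leNk p q ->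
  ip (shift n x) p q = ip x (p + n) (q + n).
Proof. exact: shift_funE. Qed.

(** "mu x": the infinite path z with z(0,d(mu)) = mu and sigma^{d(mu)}(z) = x.
    If [src mu = ip x 0 0] then [prefixP] and [prefix_unique] show that there
    is exactly one; otherwise there is none and [prefix mu x] is meaningless. *)
Definition prefix mu x : ipath L :=
  xget x [set z | ip z 0 (deg mu) = mu /\ shift (deg mu) z = x].

Let seg (la : L) p q (b : L) := exists a c, [/\ la = cmp a (cmp b c),
  src a = rng b, src b = rng c, deg a = p & p + deg b = q].

Let seg_ex la p q : leNk p q -> leNk q (deg la) -> exists b, seg la p q b.
Proof.
move=> pq ql.
have e : deg la = p + (subNk q p + subNk (deg la) q).
  by rewrite addrA !subNkK.
have [[a w] [/= [law da dw aw] _]] := kg_fact e.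
have [[b c] [/= [wbc db dc bc] _]] := kg_fact dw.
exists b, a, c; split => //; first by rewrite -wbc.
- by rewrite aw wbc rng_cmp.
- by rewrite db subNkK.
Qed.

Let seg_inj la p q b b' : seg la p q b -> seg la p q b' -> b = b'.
Proof.
move=> [a [c [e ab bc da db]]] [a' [c' [e' ab' bc' da' db']]].
have [||||_ e2] := @kg_inj k L a (cmp b c) a' (cmp b' c').
- by rewrite rng_cmp.
- by rewrite rng_cmp.
- by rewrite -e -e'.
- by rewrite da da'.
have [//|//|//||//] := @kg_inj k L b c b' c'.
by apply: (@addNkI _ p); rewrite db db'.
Qed.

Let seg_cmp la rho p q b : src la = rng rho -> seg la p q b ->
  seg (cmp la rho) p q b.
Proof.
move=> lr [a [c [e ab bc da db]]].
have abc : src a = rng (cmp b c) by rewrite rng_cmp.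
have cr : src c = rng rho by rewrite -lr e !src_cmp.
exists a, (cmp c rho); split => //; last by rewrite rng_cmp.
by rewrite e -cmpA ?src_cmp // -cmpA.
Qed.

Section Prefix.
Variables (mu : L) (x : ipath L).
Hypothesis mux : src mu = ip x 0 0.

Let la q := cmp mu (ip x 0 q).

Let muxq q : src mu = rng (ip x 0 q).
Proof. by rewrite ip_rng ?le0Nk. Qed.

Let deg_la q : deg (la q) = deg mu + q.
Proof. by rewrite deg_cmp // ip_deg ?le0Nk // subNk0. Qed.

Let seg_la p q q' b : leNk q q' -> seg (la q) p q b -> seg (la q') p q b.
Proof.
move=> qq' H; rewrite /la (@ip_cmp x 0 q q') ?le0Nk // cmpA //.
  by apply: seg_cmp => //; rewrite src_cmp // ip_src ?le0Nk // ip_rng.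
by rewrite ip_src ?le0Nk // ip_rng.
Qed.

Let pf (a : Omega k) : L := xget mu (seg (la (val a).2) (val a).1 (val a).2).

Let pfP p q : leNk p q -> seg (la q) p q (pf (om p q)).
Proof.
move=> pq; rewrite /pf omK //=.
have [b hb] : exists b, seg (la q) p q b.
  by apply: seg_ex => //; rewrite deg_la leNk_addl.
exact: (@xgetPex _ mu (seg (la q) p q) (ex_intro _ b hb)).
Qed.

Let pf_eq p q q' b : leNk p q -> leNk q q' -> seg (la q') p q b ->
  pf (om p q) = b.
Proof. by move=> pq qq' H; apply: seg_inj H; apply: seg_la (pfP pq). Qed.

Let pf_cmp p q m : leNk p q -> leNk q m ->
  [/\ rng (pf (om p q)) = pf (om p p), src (pf (om p q)) = pf (om q q)
    & pf (om p m) = cmp (pf (om p q)) (pf (om q m))].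
Proof.
move=> pq qm.
have [a [c [e ab bc da db]]] := seg_la qm (pfP pq).
set b := pf (om p q) in e ab bc db *.
have abc : src a = rng (cmp b c) by rewrite rng_cmp.
split.
- apply/esym/(@pf_eq p p m _ (leNkk _) (leNk_trans pq qm)).
  exists a, (cmp b c); split; rewrite ?rng_rng ?src_rng ?rng_cmp ?deg_rng ?addr0 //.
  by rewrite -(rng_cmp bc) cmp_rng.
- apply/esym/(@pf_eq q q m _ (leNkk _) qm).
  exists (cmp a b), c; split; rewrite ?src_cmp ?src_src ?rng_src ?deg_src ?addr0 //.
  + by rewrite bc cmp_rng e cmpA.
  + by rewrite deg_cmp // da.
- have dc : leNk (subNk m q) (deg c).
    have := deg_la m; rewrite e !deg_cmp // da addrA db => ecm.
    apply/leNkP => i; move/ffunP: ecm => /(_ i); rewrite !ffunE => ecm.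
    rewrite leq_subLR; move: ecm; rewrite !natrDE => ->.
    exact: leq_addl.
  have [[b' c'] [/= [cbc db' dc' bc'] _]] := kg_fact (esym (subNkK dc)).
  have bb' : src b = rng b' by rewrite bc cbc rng_cmp.
  have -> : pf (om q m) = b'.
    apply: (@pf_eq q m m _ qm (leNkk _)); exists (cmp a b), c'; split => //.
    + by rewrite e cbc -!cmpA // ?rng_cmp.
    + by rewrite src_cmp.
    + by rewrite deg_cmp // da.
    + by rewrite db' subNkK.
  apply: (@pf_eq p m m _ (leNk_trans pq qm) (leNkk _)).
  exists a, c'; split => //.
  + by rewrite e cbc (cmpA bb').
  + by rewrite rng_cmp.
  + by rewrite src_cmp.
  + by rewrite deg_cmp // addrA db db' subNkK.
Qed.

Let pf_functor : kg_functor pf.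
Proof.
split.
- elim/omP => p q h; have [-> _ _] := pf_cmp h (leNkk q).
  by rewrite /= /om_rng omK.
- elim/omP => p q h; have [_ -> _] := pf_cmp h (leNkk q).
  by rewrite /= /om_src omK.
- elim/omP => p q h; elim/omP => q' m h'.
  rewrite /= /om_src /om_rng /om_cmp !omK //=.
  move=> /(om_inj (leNkk _) (leNkk _)) [e _]; subst q'.
  by have [_ _ ->] := pf_cmp h h'.
- elim/omP => p q h; have [a [c [_ _ _ _ db]]] := pfP h.
  by apply: (@addNkI _ p); rewrite db /= /om_deg omK //= subNkK.
Qed.

Lemma prefixP :
  ip (prefix mu x) 0 (deg mu) = mu /\ shift (deg mu) (prefix mu x) = x.
Proof.
apply: (@xgetPex _ x [set z | ip z 0 (deg mu) = mu /\ shift (deg mu) z = x]).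
exists (IPath pf_functor); split => /=.
  apply: (@pf_eq 0 (deg mu) (deg mu) _ (le0Nk _) (leNkk _)).
  exists (rng mu), (ip x 0 (deg mu)).
  rewrite src_rng deg_rng add0r; split => //.
  by rewrite -(rng_cmp (muxq (deg mu))) cmp_rng.
apply: ip_eq => p q pq; rewrite shiftE //=.
apply: (@pf_eq _ _ (q + deg mu)); rewrite ?leNk_add ?leNkk //.
have qm : leNk q (q + deg mu) := leNk_addr _ _.
exists (la p), (ip x q (q + deg mu)); split.
- rewrite -(ip_cmp x pq qm) /la -cmpA //.
    by rewrite -ip_cmp ?le0Nk // (leNk_trans pq qm).
  by rewrite ip_src ?le0Nk // ip_rng // (leNk_trans pq qm).
- by rewrite src_cmp // ip_src ?le0Nk // ip_rng.
- by rewrite ip_src // ip_rng.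
- by rewrite deg_la addrC.
- by rewrite ip_deg // addrAC subNkK.
Qed.

End Prefix.

Lemma prefix_unique mu x z :
  ip z 0 (deg mu) = mu -> shift (deg mu) z = x -> z = prefix mu x.
Proof.
move=> z1 z2.
have mux : src mu = ip x 0 0.
  by rewrite -z2 shiftE ?leNkk // add0r -{1}z1 ip_src ?le0Nk.
have [w1 w2] := prefixP mux; set w := prefix mu x in w1 w2 *.
apply: ip_eq => p q pq.
have qm : leNk q (q + deg mu) := leNk_addr _ _.
have key t : ip t 0 (deg mu) = mu -> shift (deg mu) t = x ->
    seg (cmp mu (ip x 0 q)) p q (ip t p q).
  move=> t1 t2; exists (ip t 0 p), (ip t q (q + deg mu)); split.
  - rewrite -(ip_cmp t pq qm) -ip_cmp ?le0Nk ?(leNk_trans pq qm) //.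
    rewrite -t2 shiftE ?le0Nk // add0r -{1}t1 -ip_cmp ?le0Nk //.
    exact: leNk_addl.
  - by rewrite ip_src ?le0Nk // ip_rng.
  - by rewrite ip_src // ip_rng.
  - by rewrite ip_deg ?le0Nk // subNk0.
  - by rewrite ip_deg // subNkK.
by apply: seg_inj (key z z1 z2) (key w w1 w2).
Qed.

(** The cylinder set Z(mu). *)
Definition cyl mu : set (ipath L) :=
  [set prefix mu x | x in [set x | ip x 0 0 = src mu]].

Lemma cylE mu z : cyl mu z <-> ip z 0 (deg mu) = mu.
Proof.
split=> [[x /= xmu <-]|zmu]; first by case: (prefixP (esym xmu)).
exists (shift (deg mu) z); last by apply/esym/prefix_unique.
by rewrite /mkset shiftE ?leNkk // add0r -(ip_src z (le0Nk _)) zmu.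
Qed.

Lemma cyl_cover : \bigcup_(A in range cyl) A = setT.
Proof.
apply/seteqP; split => // z _.
exists (cyl (ip z 0 0)); first by exists (ip z 0 0).
by apply/cylE; rewrite ip_deg ?leNkk // subNkk.
Qed.

Lemma cyl_join (A B : set (ipath L)) (z : ipath L) :
  range cyl A -> range cyl B -> A z -> B z ->
  exists C, [/\ range cyl C, C z & C `<=` A `&` B].
Proof.
move=> [mu _ <-] [nu _ <-] /cylE zmu /cylE znu.
pose n := maxNk (deg mu) (deg nu).
have dn : deg (ip z 0 n) = n by rewrite ip_deg ?le0Nk // subNk0.
exists (cyl (ip z 0 n)); split; [by exists (ip z 0 n) | by apply/cylE; rewrite dn |].
have sub la : leNk (deg la) n -> ip z 0 (deg la) = la ->
    cyl (ip z 0 n) `<=` cyl la.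
  move=> lan zla w /cylE; rewrite dn => wn; apply/cylE.
  have [|||| //] := @kg_inj k L (ip w 0 (deg la)) (ip w (deg la) n)
    (ip z 0 (deg la)) (ip z (deg la) n).
  - by rewrite ip_src ?le0Nk // ip_rng.
  - by rewrite ip_src ?le0Nk // ip_rng.
  - by rewrite -!ip_cmp ?le0Nk.
  - by rewrite !ip_deg ?le0Nk.
  - by move=> -> _.
by move=> w cw; split; apply: sub cw => //; apply/leNkP => i; rewrite ffunE;
  [exact: leq_maxl | exact: leq_maxr].
Qed.

End Paths.

HB.instance Definition _ (k : nat) (L : kgraph k) :=
  @isBaseTopological.Build (ipath L) (set (ipath L)) (range (@cyl k L)) id
    (@cyl_cover k L) (@cyl_join k L).

Definition aperiodic (k : nat) (L : kgraph k) : Prop :=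
  forall v : L, paths L 0 v -> exists2 x : ipath L, ip x 0 0 = v &
    forall m n : Nk k, m <> n -> shift m x <> shift n x.

(** ** C*-algebras, not assumed to be unital *)

Record cstarAlg (R : realType) := CStarAlg {
  cs_sort :> completeNormedModType R[i];
  cmul : cs_sort -> cs_sort -> cs_sort;
  cadj : cs_sort -> cs_sort;
  cmulA : forall a b c, cmul a (cmul b c) = cmul (cmul a b) c;
  cmul_linl : forall z a b c, cmul (z *: a + b) c = z *: cmul a c + cmul b c;
  cmul_linr : forall z a b c, cmul a (z *: b + c) = z *: cmul a b + cmul a c;
  cadj_lin : forall z a b, cadj (z *: a + b) = z^* *: cadj a + cadj b;
  cadjK : forall a, cadj (cadj a) = a;
  cadjM : forall a b, cadj (cmul a b) = cmul (cadj b) (cadj a);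
  cnormM : forall a b, `|cmul a b| <= `|a| * `|b|;
  cnorm_cstar : forall a, `|cmul (cadj a) a| = `|a| ^+ 2
}.

Section CStar.
Variable R : realType.
Implicit Types A B : cstarAlg R.

Definition is_unit A (e : A) : Prop :=
  forall a : A, cmul e a = a /\ cmul a e = a.

Definition is_projection A (p : A) : Prop := cadj p = p /\ cmul p p = p.

Definition is_partial_isometry A (a : A) : Prop := cmul (cmul a (cadj a)) a = a.

(** In particular the algebra is unital. *)
Definition is_unitary A (u : A) : Prop :=
  is_unit (cmul (cadj u) u) /\ is_unit (cmul u (cadj u)).

Definition star_hom A B (f : A -> B) : Prop :=
  [/\ forall (z : R[i]) a b, f (z *: a + b) = z *: f a + f b,
      forall a b, f (cmul a b) = cmul (f a) (f b)
    & forall a, f (cadj a) = cadj (f a)].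

Definition is_cstar_subalgebra A (S : set A) : Prop :=
  [/\ S 0, forall (z : R[i]) a b, S a -> S b -> S (z *: a + b),
      forall a b, S a -> S b -> S (cmul a b),
      forall a, S a -> S (cadj a) & closed S].

Definition generates A (D : set A) : Prop :=
  forall S : set A, is_cstar_subalgebra S -> D `<=` S -> S = setT.

End CStar.

(** ** The C*-algebra of a k-graph *)

Section KGraphAlgebra.
Variables (R : realType) (k : nat) (L : kgraph k).

Definition ck_family (A : cstarAlg R) (s : L -> A) : Prop :=
  [/\ forall mu, is_partial_isometry (s mu),
      (forall v, paths L 0 v -> is_projection (s v)) /\
      (forall v w, paths L 0 v -> paths L 0 w -> v <> w ->
         cmul (s v) (s w) = 0),
      forall mu nu, src mu = rng nu -> s (cmp mu nu) = cmul (s mu) (s nu),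
      forall mu, cmul (cadj (s mu)) (s mu) = s (src mu)
    & forall v n, paths L 0 v ->
        s v = \sum_(mu \in paths_from v n) cmul (s mu) (cadj (s mu))].

(** [(O, s)] is "the" universal C*-algebra generated by a family satisfying
    these relations; this determines it up to unique isomorphism. *)
Definition universal_ck (O : cstarAlg R) (s : L -> O) : Prop :=
  [/\ ck_family s, generates (range s)
    & forall (B : cstarAlg R) (t : L -> B), ck_family t ->
        exists2 f : O -> B, star_hom f & forall mu, f (s mu) = t mu].

Variables (O : cstarAlg R) (s : L -> O).

(** [U] is the sum of the s_alpha s_beta^* over the pairs (alpha, beta) in
    the list [l], and s(alpha) = s(beta) for each of them. *)
Definition ht_sum (l : seq (L * L)) (U : O) : Prop :=
  (forall ab, ab \in l -> src ab.1 = src ab.2) /\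
  U = \sum_(ab <- l) cmul (s ab.1) (cadj (s ab.2)).

Definition ht_group : set O :=
  [set U | is_unitary U /\ exists l, ht_sum l U].

Definition is_ht_action (phi : O -> ipath L -> ipath L) : Prop :=
  forall (U : O) (l : seq (L * L)), ht_group U -> ht_sum l U ->
  forall ab, ab \in l -> forall y : ipath L, ip y 0 0 = src ab.2 ->
    phi U (prefix ab.2 y) = prefix ab.1 y.

End KGraphAlgebra.

(** ** Group actions on topological spaces *)

(** A group is given as a subset [G] of a type [T] with a multiplication, and
    an action as a map [act : T -> X -> X], of which only the values [act g]
    for [g] in [G] matter. *)

Section Actions.
Variables (T : Type) (G : set T) (mul : T -> T -> T).

Definition is_identity (e : T) : Prop :=
  G e /\ forall g, G g -> mul e g = g /\ mul g e = g.

Definition is_group : Prop :=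
  [/\ forall g h, G g -> G h -> G (mul g h),
      forall f g h, G f -> G g -> G h -> mul f (mul g h) = mul (mul f g) h
    & exists2 e, is_identity e &
        forall g, G g -> exists2 h, G h & mul g h = e /\ mul h g = e].

Variables (X : topologicalType) (act : T -> X -> X).

Definition is_homeomorphism (f : X -> X) : Prop :=
  continuous f /\ exists2 g : X -> X, continuous g & cancel f g /\ cancel g f.

Definition is_action_by_homeo : Prop :=
  [/\ is_group,
      forall g, G g -> is_homeomorphism (act g),
      forall e, is_identity e -> forall x, act e x = x
    & forall g h, G g -> G h -> forall x, act (mul g h) x = act g (act h x)].

Definition minimal_action : Prop :=
  forall x : X, dense [set act g x | g in G].

Definition compressible (C : set X) : Prop :=
  exists x : X, forall N : set X, nbhs x N ->
    exists2 g, G g & act g @` C `<=` N.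

Definition extremely_proximal : Prop :=
  forall C : set X, closed C -> C `<` setT -> compressible C.

Definition extreme_boundary_action : Prop :=
  [/\ is_action_by_homeo, compact [set: X], minimal_action
    & extremely_proximal].

End Actions.

(* Main.v *)
From Pilot Require (* Gives back to [prefix] its meaning for infinite paths. *)
Import Defs.
From HB Require Import structures.
From mathcomp Require Import all_boot all_order all_algebra.
From mathcomp Require Import finmap complex ring lra.
From mathcomp Require Import all_classical all_reals all_analysis.
Import Defs.

Set Implicit Arguments.
Unset Strict Implicit.
Unset Printing Implicit Defensive.

Import Order.TTheory GRing.Theory Num.Theory.
Import numFieldNormedType.Exports.

Local Open Scope classical_set_scope.
Local Open Scope ring_scope.

(** The key is the regular representation of the k-graph on the Hilbert space
    of square-summable functions on the infinite paths, in which [s_mu] sends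
    the basis vector of [x] to that of [mu x]. It satisfies the Cuntz-Krieger
    relations, so universality provides a *-homomorphism [f] out of the
    C*-algebra. If the unitary [U] is the sum of the [s_a s_b^*] over a list of
    pairs, then [f U] sends the basis vector of [x] to the sum of the basis
    vectors of [a y] over the pairs [(a, b)] with [x = b y]. As [f U] is
    isometric this is a unit vector, and a sum of basis vectors is a unit vector
    only if it has one term ([delta_sum_unit]). Hence [x] lies in exactly one
    [Z(b)], and [phi U x] is the path whose basis vector is the image under
    [f U] of that of [x]: it depends on [U] alone ([ht_map_action]), and
    [phi (U V) = phi U \o phi V] because [f] is multiplicative and basis vectors
    are distinct ([phi_mul]).

    The concrete representation lives in the C*-algebra of bounded adjointable
    operators of a Hilbert space ([bop_cstarAlg]), applied to [ell2_hilbert].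

    That unitaries of this form are closed under products needs
    [s_b^* s_c] to be again a finite sum of terms [s_a s_d^*]. Inserting
    the sum of all [s_la s_la^*] with [la] of degree [d(b) + d(c)], which is the
    unit, reduces this to [s_b^* s_b' = 0] for distinct paths of equal degree,
    that is, to the orthogonality of isometries whose range projections add up
    to the unit. In an abstract C*-algebra this says that positive elements
    cannot cancel. It is derived here from the C*-identity alone, through the
    fact that the unit is an extreme point of the unit ball
    ([four_contractions_eq0], [no_cancellation], [isometries_orthogonal]).
    Conversely the orthogonality makes a sum of [s_a s_b^*] unitary as soon as
    the range projections of the [a]'s, and those of the [b]'s, add up to the
    unit ([ht_unitary]).

    The dynamics is then combinatorial. The path space is compact because an
    ultrafilter on it has a pointwise limit, each coordinate having finitely
    many values. It is minimal because a permutation of the paths of a given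
    degree is induced by an element of the group. For extreme proximality, let a
    closed set miss [Z(mu)], with [d(mu) = m], and let [nu] be a target, with
    [d(nu) = n]. The complement of [Z(mu)] is sent into [Z(nu)] by prefixing
    [nu]. What remains to be matched is [Z(mu)], cut into the [Z(mu la)] for
    [d(la) = n], with the complement of the image, cut into the [Z(la)] for
    [la <> nu] and [Z(nu mu)]: there are as many pieces on both sides. *)

(** * Bounded operators on a Hilbert space *)

(** Evaluate at the minimum [t = - b / c]. With the square of the norm of
    [x + t y] this gives the Cauchy-Schwarz inequality for a semi-definite
    form. *)
Lemma psd_discriminant (R : realFieldType) (a b c : R) : 0 <= a -> 0 <= c ->
  (forall t, 0 <= a + 2 * t * b + t ^+ 2 * c) -> b ^+ 2 <= a * c.
Proof.
move=> a0 c0 pos; have [cz|cn] := eqVneq c 0.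
  have [->|bn] := eqVneq b 0; first by rewrite expr0n mulr_ge0.
  have := pos (- (a + 1) / (2 * b)); rewrite cz mulr0 addr0.
  have -> : a + 2 * (- (a + 1) / (2 * b)) * b = - 1 by field.
  by rewrite oppr_ge0 ler10.
have cp : 0 < c by rewrite lt_def cn.
have := pos (- b / c); rewrite -(pmulr_lge0 _ cp).
suff -> : (a + 2 * (- b / c) * b + (- b / c) ^+ 2 * c) * c = a * c - b ^+ 2.
  by rewrite subr_ge0.
by field.
Qed.

(** [hip] is the real part of the Hermitian inner product. It carries the same
    information: [hipZ] recovers the sesquilinearity, and an operator that is
    linear over the complex numbers has the same adjoint for both forms. *)
Record hilbert (R : realType) := Hilbert {
  hsp :> completeNormedModType R[i];
  hip : hsp -> hsp -> R;
  hipC : forall x y, hip x y = hip y x;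
  hipDl : forall x y z, hip (x + y) z = hip x z + hip y z;
  hipZr : forall (a : R) x y, hip (a%:C%C *: x) y = a * hip x y;
  hipZ : forall (z : R[i]) x y, hip (z *: x) y = hip x (z^* *: y);
  hip_norm : forall x, (hip x x)%:C%C = `|x| ^+ 2
}.

Section InnerProduct.
Local Open Scope complex_scope.
Variables (R : realType) (H : hilbert R).
Implicit Types x y z : H.

Lemma hipDr x y z : hip x (y + z) = hip x y + hip x z.
Proof. by rewrite hipC hipDl ![hip _ x]hipC. Qed.

Lemma hipZrr (a : R) x y : hip x (a%:C *: y) = a * hip x y.
Proof. by rewrite hipC hipZr [hip _ x]hipC. Qed.

Lemma hip0l y : hip 0 y = 0 :> R.
Proof. by rewrite -(scale0r (0 : H)) (hipZr 0) mul0r. Qed.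

Lemma hipBl x y z : hip (x - y) z = hip x z - hip y z.
Proof.
by apply/eqP; rewrite eq_sym subr_eq -hipDl subrK.
Qed.

Lemma hip_ge0 x : 0 <= hip x x.
Proof. by rewrite -lecR hip_norm exprn_ge0. Qed.

Lemma hip_eq0 x : hip x x = 0 -> x = 0.
Proof.
by move=> xx; apply/eqP; rewrite -normr_eq0 -sqrf_eq0 -hip_norm xx.
Qed.

Lemma hip_inj x y : (forall z, hip x z = hip y z) -> x = y.
Proof.
move=> e; apply/eqP; rewrite -subr_eq0; apply/eqP/hip_eq0.
by rewrite hipBl e subrr.
Qed.

Lemma cauchy_schwarz x y : `|hip x y|%:C <= `|x| * `|y|.
Proof.
have sq : hip x y ^+ 2 <= hip x x * hip y y.
  apply: psd_discriminant; rewrite ?hip_ge0 // => t.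
  have := hip_ge0 (x + t%:C *: y).
  rewrite !(hipDl, hipDr, hipZr, hipZrr) [hip y x]hipC; lra.
rewrite -(@ler_pXn2r _ 2) ?nnegrE ?mulr_ge0 ?ler0c //.
rewrite exprMn -!hip_norm -rmorphXn -rmorphM /= lecR.
by rewrite real_normK ?num_real.
Qed.

(** Limits are taken along arbitrary filters, since the completeness of the
    algebra of operators is stated for Cauchy filters. *)
Lemma hip_cvg (T : Type) (F : set_system T) {FF : Filter F}
    (f : T -> H) (l y : H) :
  f t @[t --> F] --> l -> hip (f t) y @[t --> F] --> hip l y.
Proof.
move=> fl; apply/cvgrPdist_le => e e0.
pose c := complex.Re `|y| + 1.
have yc : `|y| <= c%:C.
  by rewrite rmorphD /= -[X in X <= _]RRe_real ?normr_real // lerDl.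
have c0 : 0 < c.
  by rewrite ltr_wpDl // -ler0c RRe_real ?normr_real.
have ec : 0 < (e / c)%:C by rewrite ltcR divr_gt0.
near=> t.
rewrite -hipBl -lecR; apply: le_trans (cauchy_schwarz _ _) _.
have -> : e%:C = (e / c)%:C * c%:C by rewrite -rmorphM /= divfK ?gt_eqF.
apply: ler_pM => //; near: t.
by move/cvgrPdist_le : fl => /(_ _ ec).
Unshelve. all: by end_near. Qed.

End InnerProduct.

Section Operators.
Local Open Scope complex_scope.
Variables (R : realType) (H : hilbert R).
Implicit Types (T S : H -> H) (x y : H) (M : R).

Definition adjoint T S := forall x y, hip (T x) y = hip x (S y).

Definition bounded T := exists2 M : R, 0 <= M & forall x, `|T x| <= M%:C * `|x|.

(** The adjoint is required to exist rather than obtained from the Riesz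
    representation theorem. *)
Definition boperator T := [/\ linear T, bounded T & exists S, adjoint T S].

Lemma adjointC T S : adjoint T S -> adjoint S T.
Proof. by move=> a x y; rewrite hipC -a hipC. Qed.

Lemma adjoint_unique T S S' : adjoint T S -> adjoint T S' -> S = S'.
Proof.
move=> a a'; apply/funext => y; apply: hip_inj => x.
by rewrite ![hip _ x]hipC -a -a'.
Qed.

Lemma linear_scale T z x : linear T -> T (z *: x) = z *: T x.
Proof.
move=> lT; have T0 : T 0 = 0.
  by apply/(addrI (T 0)); rewrite -{1}[T 0]scale1r -lT scale1r !addr0.
by rewrite -[z *: x]addr0 lT T0 addr0.
Qed.

(** The form being definite, linearity of one member of an adjoint pair can be
    tested on the other one. *)
Lemma adjoint_linear T S : linear T -> adjoint T S -> linear S.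
Proof.
move=> lT /adjointC a z x y; apply: hip_inj => u.
by rewrite a !hipDl (hipZ _ x) -(linear_scale _ _ lT) -!a -hipZ.
Qed.

(** [|S y|^2 = (T (S y), y) <= M |S y| |y|], and [|S y|] can be cancelled. *)
Lemma adjoint_bounded T S M : 0 <= M -> adjoint T S ->
  (forall x, `|T x| <= M%:C * `|x|) -> forall y, `|S y| <= M%:C * `|y|.
Proof.
move=> M0 a bT y.
have [->|Sy] := eqVneq (S y) 0; first by rewrite normr0 mulr_ge0 ?ler0c.
have Sy0 : 0 < `|S y| by rewrite normr_gt0.
rewrite -(ler_pM2l Sy0) -expr2 -hip_norm -a.
apply: le_trans (_ : `|hip (T (S y)) y|%:C <= _); first by rewrite lecR ler_norm.
apply: le_trans (cauchy_schwarz _ _) _.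
by rewrite mulrCA mulrA ler_wpM2r.
Qed.

Lemma boperator_linear T : boperator T -> linear T.
Proof. by case. Qed.

(** The infimum of these bounds is again one of them ([opnormP]). *)
Definition opnorms T := [set M | 0 <= M /\ forall x, `|T x| <= M%:C * `|x|].

Definition opnorm T : R := inf (opnorms T).

Lemma opnorms_lb T : has_lbound (opnorms T).
Proof. by exists 0 => M []. Qed.

Lemma opnorm_le T M : 0 <= M -> (forall x, `|T x| <= M%:C * `|x|) ->
  opnorm T <= M.
Proof. by move=> M0 hM; apply: ge_inf; [exact: opnorms_lb|]. Qed.

Lemma opnorm_ge0 T : bounded T -> 0 <= opnorm T.
Proof.
by move=> [M M0 hM]; apply: lb_le_inf; [exists M|move=> ? []].
Qed.

Lemma opnormP T x : bounded T -> `|T x| <= (opnorm T)%:C * `|x|.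
Proof.
move=> bT; have [x0|x0] := eqVneq `|x| 0.
  by have [M _ /(_ x)] := bT; rewrite x0 !mulr0.
have xp : 0 < `|x| by rewrite lt_def x0 normr_ge0.
have nr : `|x| = (complex.Re `|x|)%:C by rewrite RRe_real ?normr_real.
have nT : `|T x| = (complex.Re `|T x|)%:C by rewrite RRe_real ?normr_real.
have rp : 0 < complex.Re `|x| by rewrite -ltcR -nr.
rewrite nr nT -rmorphM lecR -ler_pdivrMr //.
case: bT => M M0 hM; apply: lb_le_inf; first by exists M.
move=> m [m0 hm]; rewrite ler_pdivrMr //.
by rewrite -lecR rmorphM /= -nr -nT.
Qed.

Lemma boperator_comp T T' : boperator T -> boperator T' ->
  boperator (T \o T').
Proof.
move=> [lT [M M0 bT] [S a]] [lT' [M' M0' bT'] [S' a']]; split.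
- by move=> z x y /=; rewrite lT' lT.
- exists (M * M'); first exact: mulr_ge0.
  move=> x /=; apply: le_trans (bT _) _; rewrite rmorphM /= -mulrA.
  by rewrite ler_wpM2l ?ler0c.
- by exists (S' \o S) => x y /=; rewrite a a'.
Qed.

Lemma boperator_adjoint T S : boperator T -> adjoint T S -> boperator S.
Proof.
move=> [lT [M M0 bT] _] a; split; first exact: adjoint_linear a.
  by exists M => //; exact: adjoint_bounded bT.
by exists T; exact: adjointC.
Qed.

Lemma boperator0 : boperator (0 : H -> H).
Proof.
split; [by move=> z x y; rewrite scaler0 addr0| |].
  by exists 0 => // x; rewrite normr0 mul0r.
by exists 0 => x y; rewrite hip0l hipC hip0l.
Qed.

Lemma adjoint_lincomb z T T' S S' : linear T -> adjoint T S -> adjoint T' S' ->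
  adjoint (z *: T + T') (z^* *: S + S').
Proof.
move=> lT a a' x y.
rewrite -[(z *: T + T') x]/(z *: T x + T' x).
rewrite -[(z^* *: S + S') y]/(z^* *: S y + S' y).
by rewrite hipDl hipDr -hipZ -a -a' (linear_scale _ _ lT).
Qed.

Lemma boperator_lincomb z T T' : boperator T -> boperator T' ->
  boperator (z *: T + T').
Proof.
move=> [lT [M M0 bT] [S a]] [lT' [M' M0' bT'] [S' a']]; split.
- move=> w x y; rewrite -[LHS]/(z *: T (w *: x + y) + T' (w *: x + y)).
  rewrite -[RHS]/(w *: (z *: T x + T' x) + (z *: T y + T' y)) lT lT'.
  by rewrite !scalerDr !scalerA mulrC addrACA.
- pose c := complex.Re `|z|.
  have zc : `|z| = c%:C by rewrite RRe_real ?normr_real.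
  exists (c * M + M'); first by rewrite addr_ge0 // mulr_ge0 // -ler0c -zc.
  move=> x; apply: le_trans (ler_normD _ _) _.
  rewrite normrZ zc rmorphD mulrDl lerD // rmorphM -mulrA ler_wpM2l //.
  by rewrite -zc.
- by exists (z^* *: S + S'); exact: adjoint_lincomb.
Qed.

End Operators.

Section OperatorAlgebra.
Local Open Scope complex_scope.
Variables (R : realType) (H : hilbert R).

Definition boperatorb : pred (H -> H) := fun T => `[< boperator T >].

Record bop := BOp { bop_fun :> H -> H; bop_prop : boperatorb bop_fun }.

HB.instance Definition _ := [isSub for bop_fun].
HB.instance Definition _ := [Choice of bop by <:].

Lemma bopP (T : bop) : boperator T.
Proof. exact/asboolP/(valP T). Qed.

Lemma bop_submod : submod_closed boperatorb.
Proof.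
split; first by apply/asboolP; exact: boperator0.
by move=> z S T /asboolP bS /asboolP bT; apply/asboolP; exact: boperator_lincomb.
Qed.
HB.instance Definition _ := GRing.isSubmodClosed.Build R[i] (H -> H)
  boperatorb bop_submod.
HB.instance Definition _ := [SubChoice_isSubLmodule of bop by <:].

Lemma bopE z (T S : bop) x : (z *: T + S) x = z *: T x + S x.
Proof. by []. Qed.

Lemma bopD (T S : bop) x : (T + S) x = T x + S x.
Proof. by []. Qed.

Lemma bopB (T S : bop) x : (T - S) x = T x - S x.
Proof. by []. Qed.

Lemma bopZ z (T : bop) x : (z *: T) x = z *: T x.
Proof. by []. Qed.

Lemma bop_eq (T S : bop) : T =1 S -> T = S.
Proof. by move=> e; apply/val_inj/funext. Qed.

Lemma bop_bounded (T : bop) : bounded T.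
Proof. by case: (bopP T). Qed.

Definition bop_norm (T : bop) : R[i] := (opnorm T)%:C.

Lemma bop_normP (T : bop) x : `|T x| <= bop_norm T * `|x|.
Proof. exact/opnormP/bop_bounded. Qed.

Lemma bop_norm_ge0 T : 0 <= bop_norm T.
Proof. by rewrite ler0c; exact/opnorm_ge0/bop_bounded. Qed.

Lemma bop_norm_le (T : bop) (c : R[i]) : 0 <= c ->
  (forall x, `|T x| <= c * `|x|) -> bop_norm T <= c.
Proof.
move=> c0; have cE : c = (complex.Re c)%:C by rewrite RRe_real ?ger0_real.
rewrite cE => h; rewrite lecR; apply: opnorm_le => //.
by rewrite -ler0c -cE.
Qed.

Lemma bop_normD S T : bop_norm (S + T) <= bop_norm S + bop_norm T.
Proof.
apply: bop_norm_le; first by rewrite addr_ge0 ?bop_norm_ge0.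
move=> x; rewrite bopD; apply: le_trans (ler_normD _ _) _.
by rewrite mulrDl lerD ?bop_normP.
Qed.

Lemma bop_normZ_le z T : bop_norm (z *: T) <= `|z| * bop_norm T.
Proof.
apply: bop_norm_le; first by rewrite mulr_ge0 ?bop_norm_ge0.
by move=> x; rewrite bopZ normrZ -mulrA ler_wpM2l ?bop_normP.
Qed.

Lemma bop_normZ z T : bop_norm (z *: T) = `|z| * bop_norm T.
Proof.
apply/eqP; rewrite eq_le bop_normZ_le /=.
have [->|z0] := eqVneq z 0; first by rewrite normr0 mul0r bop_norm_ge0.
have nz : 0 < `|z| by rewrite normr_gt0.
rewrite -ler_pdivlMl // -normfV.
by apply: le_trans (bop_normZ_le _ _); rewrite scalerA mulVf // scale1r.
Qed.

Lemma bop_norm_eq0 T : bop_norm T = 0 -> T = 0.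
Proof.
move=> T0; apply: bop_eq => x; apply/eqP; rewrite -normr_le0.
by have := bop_normP T x; rewrite T0 mul0r.
Qed.

HB.instance Definition _ := Lmodule_isNormed.Build R[i] bop
  bop_normD bop_normZ bop_norm_eq0.

Definition badj (T : bop) : bop :=
  let: exist T' aT := cid (let: And3 _ _ e := bopP T in e) in
  BOp (asboolT (boperator_adjoint (bopP T) aT)).

Lemma badjP (T : bop) : adjoint T (badj T).
Proof. by rewrite /badj; case: cid. Qed.

Lemma badj_eq (T S : bop) : adjoint T S -> badj T = S.
Proof.
by move=> a; apply/val_inj; apply: adjoint_unique a; exact: badjP.
Qed.

Lemma badjK T : badj (badj T) = T.
Proof. exact/badj_eq/adjointC/badjP. Qed.

Lemma badj_lin z S T : badj (z *: S + T) = z^* *: badj S + badj T.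
Proof.
apply: badj_eq; apply: adjoint_lincomb; [|exact: badjP..].
exact/boperator_linear/bopP.
Qed.

Lemma badjB S T : badj (S - T) = badj S - badj T.
Proof. by rewrite addrC -scaleN1r badj_lin rmorphN1 scaleN1r addrC. Qed.

Lemma badj_norm T : bop_norm (badj T) = bop_norm T.
Proof.
have le S : bop_norm (badj S) <= bop_norm S.
  apply: bop_norm_le; first exact: bop_norm_ge0.
  by apply: adjoint_bounded (badjP S) _;
    [exact/opnorm_ge0/bop_bounded|exact: bop_normP].
by apply/eqP; rewrite eq_le le -{1}[T]badjK le.
Qed.

(** The norm takes values in the partially ordered field [R[i]], where bounds do
    not pass to limits by order-topology arguments; but norms are real, hence
    comparable. *)
Lemma norm_cvg_le (V : normedModType R[i]) (T : Type) (F : set_system T)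
    (FF : ProperFilter F) (f : T -> V) (l a : V) (c : R[i]) :
  f t @[t --> F] --> l -> (\forall t \near F, `|f t - a| <= c) -> `|l - a| <= c.
Proof.
move=> fl fc.
have [t0 /= ft0] := filter_ex fc.
have cR : c \is Num.real by rewrite ger0_real // (le_trans _ ft0).
rewrite real_leNgt ?normr_real //; apply/negP => cl.
move/cvgrPdist_lt : fl => /(_ (`|l - a| - c)); rewrite subr_gt0 => /(_ cl) fl.
have [t [/= h1 h2]] := filter_ex (filterI fl fc).
have := le_lt_trans (ler_distD (f t) l a) (ltr_leD h1 h2).
by rewrite subrK ltxx.
Qed.

(** With [u] the identity or the adjoint map, this provides the candidate limit
    of a Cauchy filter together with its adjoint. *)
Lemma cauchy_pointwise (F : set_system bop) (u : bop -> H -> H) x :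
  ProperFilter F -> cauchy F ->
  (forall S T, `|u S x - u T x| <= `|S - T| * `|x|) ->
  cvg (u T x @[T --> F]).
Proof.
move=> FF cF hu; apply/cauchy_cvgP/cauchy_exP => e e0.
have c0 : 0 < `|x| + 1 by rewrite ltr_wpDl.
have /cauchyP/(_ (e / (`|x| + 1))) [|T FT] := cF; first by rewrite divr_gt0.
exists (u T x); suff : \forall S \near F, ball (u T x) e (u S x) by [].
apply: filterS FT => S; rewrite -!ball_normE /= => TS.
apply: le_lt_trans (hu _ _) _.
apply: le_lt_trans (_ : `|T - S| * (`|x| + 1) < _).
  by rewrite ler_wpM2l // lerDl.
by rewrite -ltr_pdivlMr.
Qed.

(** The pointwise limits of the operators and of their adjoints form an adjoint
    pair, by continuity of the inner product; the Cauchy estimate is uniform, so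
    it passes to the limit and gives both boundedness and convergence in norm. *)
Lemma bop_complete (F : set_system bop) : ProperFilter F -> cauchy F -> cvg F.
Proof.
move=> FF cF.
have normE (T : bop) : `|T| = bop_norm T by [].
pose ev x (T : bop) := T x.
pose G x : H := lim (ev x @ F).
have GF x : ev x @ F --> G x.
  apply: (@cauchy_pointwise F bop_fun) => // S T.
  by rewrite -bopB normE bop_normP.
pose G' x : H := lim (badj T x @[T --> F]).
have GF' x : badj T x @[T --> F] --> G' x.
  apply: (@cauchy_pointwise F (fun T => badj T)) => // S T.
  by rewrite -bopB normE -badj_norm badjB bop_normP.
have lG : linear G.
  move=> z x y; apply: (@cvg_unique _ _ (ev (z *: x + y) @ F)) => //; first exact: GF.
  have -> : ev (z *: x + y) = (fun T => z *: ev x T + ev y T).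
    by apply/funext => T; rewrite /ev (boperator_linear (bopP T)).
  by apply: cvgD; [apply: cvgZl_tmp; exact: GF|exact: GF].
have aG : adjoint G G'.
  move=> x y; apply: (@cvg_unique _ _ (hip (ev x T) y @[T --> F])) => //.
    exact: (hip_cvg (GF x)).
  have -> : (fun T : bop => hip (ev x T) y) = (fun T => hip (badj T y) x).
    by apply/funext => T; rewrite /ev (badjP T) hipC.
  by rewrite hipC; exact: (hip_cvg (GF' y)).
have near e : 0 < e -> exists T : bop, F (ball T e) /\
    forall S x, ball T e S -> `|G x - S x| <= (e + e) * `|x|.
  move=> e0; have /cauchyP/(_ e e0) [T FT] := cF.
  exists T; split => // S x TS; apply: (@norm_cvg_le H) (GF x) _.
  apply: filterS FT => S' TS'; rewrite -bopB; apply: le_trans (bop_normP _ _) _.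
  rewrite ler_wpM2r // -normE ltW //; move: TS TS'; rewrite -!ball_normE /=.
  move=> h1 h2; apply: le_lt_trans (ler_distD T _ _) _.
  by rewrite (distrC S') ltrD.
have [//|T [FT GT]] := near 1.
(* Any operator of a ball of radius 1 in the filter bounds the limit. *)
have bG : boperator G.
  split => //; last by exists G'.
  exists (1 + 1 + opnorm T); first by rewrite !addr_ge0 // opnorm_ge0 //; exact: bop_bounded.
  move=> x; rewrite -[G x](subrK (T x)); apply: le_trans (ler_normD _ _) _.
  rewrite rmorphD mulrDl; apply: lerD; last exact: bop_normP.
  rewrite rmorphD; apply: GT.
  by rewrite -ball_normE /= subrr normr0.
apply/cvg_ex; exists (BOp (asboolT bG)).
apply/cvgrPdist_le => e e0.
have [|S [FS GS]] := near (e / 2); first by rewrite divr_gt0.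
apply: filterS FS => S' SS'; rewrite normE; apply: bop_norm_le; first exact: ltW.
by move=> x; rewrite bopB /=; apply: le_trans (GS _ _ SS') _; rewrite -splitr.
Qed.

HB.instance Definition _ := Uniform_isComplete.Build bop bop_complete.

Definition bmul (S T : bop) : bop :=
  BOp (asboolT (boperator_comp (bopP S) (bopP T))).

Lemma bmulE S T x : bmul S T x = S (T x).
Proof. by []. Qed.

Lemma bmulA S T U : bmul S (bmul T U) = bmul (bmul S T) U.
Proof. exact: bop_eq. Qed.

Lemma bmul_linl z S T U : bmul (z *: S + T) U = z *: bmul S U + bmul T U.
Proof. exact: bop_eq. Qed.

Lemma bmul_linr z S T U : bmul S (z *: T + U) = z *: bmul S T + bmul S U.
Proof.
by apply: bop_eq => x; rewrite bmulE !bopE (boperator_linear (bopP S)).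
Qed.

Lemma badjM S T : badj (bmul S T) = bmul (badj T) (badj S).
Proof. by apply: badj_eq => x y; rewrite !bmulE !badjP. Qed.

Lemma bop_normM (S T : bop) : `|bmul S T| <= `|S| * `|T|.
Proof.
apply: bop_norm_le; first exact: mulr_ge0.
move=> x; apply: le_trans (bop_normP S (T x)) _; rewrite -mulrA.
by apply: ler_wpM2l; [exact: bop_norm_ge0|exact: bop_normP].
Qed.

(** The nontrivial inequality is
    [|T x|^2 = (x, T^* T x) <= |T^* T| |x|^2]. *)
Lemma bop_cstar (T : bop) : `|bmul (badj T) T| = `|T| ^+ 2.
Proof.
apply/eqP; rewrite eq_le; apply/andP; split.
  by apply: le_trans (bop_normM _ _) _; rewrite expr2 ler_wpM2r // [leLHS]badj_norm.
set c := `|bmul (badj T) T|.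
have c0 : 0 <= c by exact: normr_ge0.
rewrite -[c]sqrtCK; apply: lerXn2r; rewrite ?nnegrE ?sqrtC_ge0 //.
apply: bop_norm_le; first by rewrite sqrtC_ge0.
move=> x; rewrite -(@ler_pXn2r _ 2) ?nnegrE ?mulr_ge0 ?sqrtC_ge0 //.
rewrite exprMn sqrtCK -hip_norm badjP -bmulE.
apply: le_trans (_ : `|hip x (bmul (badj T) T x)|%:C <= _).
  by rewrite lecR ler_norm.
apply: le_trans (cauchy_schwarz _ _) _.
rewrite expr2 [leRHS]mulrA [leRHS]mulrC.
by apply: ler_wpM2l => //; exact: bop_normP.
Qed.

Definition bop_cstarAlg : cstarAlg R :=
  @CStarAlg R bop bmul badj bmulA bmul_linl bmul_linr badj_lin badjK badjM
    bop_normM bop_cstar.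

End OperatorAlgebra.

(** * Square-summable functions on a set *)

Section NonnegativeSums.
Variables (R : realType) (X : choiceType).
Implicit Types (p q h : X -> R).

Definition nnsum p : R := fine (\esum_(x in [set: X]) (p x)%:E)%E.

Definition nnsummable p :=
  (forall x, 0 <= p x) /\ (\esum_(x in [set: X]) (p x)%:E < +oo)%E.

Lemma nnsumE p : nnsummable p ->
  (\esum_(x in [set: X]) (p x)%:E)%E = (nnsum p)%:E.
Proof.
move=> [p0 ps]; rewrite /nnsum fineK // ge0_fin_numE //.
by apply: esum_ge0 => x _; rewrite lee_fin.
Qed.

Lemma nnsum_ge0 p : (forall x, 0 <= p x) -> 0 <= nnsum p.
Proof.
by move=> p0; apply/fine_ge0/esum_ge0 => x _; rewrite lee_fin.
Qed.

Lemma nnsummableD p q : nnsummable p -> nnsummable q ->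
  nnsummable (fun x => p x + q x).
Proof.
move=> [p0 ps] [q0 qs]; split; first by move=> x; rewrite addr_ge0.
under eq_esum do rewrite EFinD.
by rewrite esumD ?lte_add_pinfty // => x _; rewrite lee_fin.
Qed.

Lemma nnsumD p q : nnsummable p -> nnsummable q ->
  nnsum (fun x => p x + q x) = nnsum p + nnsum q.
Proof.
move=> ps qs; apply: EFin_inj; rewrite EFinD -!nnsumE //; last exact: nnsummableD.
under eq_esum do rewrite EFinD.
by case: ps qs => [p0 _] [q0 _]; rewrite esumD // => x _; rewrite lee_fin.
Qed.

Lemma nnsummable_le p q : (forall x, 0 <= p x <= q x) -> nnsummable q ->
  nnsummable p.
Proof.
move=> pq [q0 qs]; split=> [x|]; first by case/andP: (pq x).
apply: le_lt_trans qs; apply: le_esum => x _.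
by rewrite lee_fin; case/andP: (pq x).
Qed.

Lemma nnsum_finite p (A : {fset X}) : nnsummable p ->
  \sum_(x <- A) p x <= nnsum p.
Proof.
move=> ps; rewrite -lee_fin -nnsumE //; apply: esum_ge.
exists [set` A] => //; rewrite fsbig_finite //= set_fsetK.
by rewrite sumEFin.
Qed.

Lemma nnsum_bound p (c : R) : (forall x, 0 <= p x) ->
  (forall A : {fset X}, \sum_(x <- A) p x <= c) -> nnsummable p /\ nnsum p <= c.
Proof.
move=> p0 pc.
have le : ((\esum_(x in [set: X]) (p x)%:E) <= c%:E)%E.
  apply: ge_ereal_sup => _ [A [fA _] <-].
  by rewrite fsbig_finite //= sumEFin lee_fin.
have ps : nnsummable p by split=> //; apply: le_lt_trans le _; exact: ltry.
by split=> //; rewrite -lee_fin -nnsumE.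
Qed.

Lemma nnsummableZ p (a : R) : 0 <= a -> nnsummable p ->
  nnsummable (fun x => a * p x) /\ nnsum (fun x => a * p x) <= a * nnsum p.
Proof.
move=> a0 ps; apply: nnsum_bound => [x|A].
  by rewrite mulr_ge0 //; case: ps.
by rewrite -mulr_sumr ler_wpM2l // nnsum_finite.
Qed.

Lemma nnsumZ p (a : R) : 0 <= a -> nnsummable p ->
  nnsum (fun x => a * p x) = a * nnsum p.
Proof.
move=> a0 ps; have [aps le] := nnsummableZ a0 ps.
apply/eqP; rewrite eq_le le /=; have [->|an] := eqVneq a 0.
  by rewrite mul0r nnsum_ge0 // => x; rewrite mul0r.
have ap : 0 < a by rewrite lt_def an.
rewrite -ler_pdivlMl //; have ai : 0 <= a^-1 by rewrite invr_ge0.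
apply: le_trans (nnsummableZ ai aps).2.
by rewrite (_ : (fun x => a^-1 * (a * p x)) = p) //; apply/funext => x; rewrite mulKf.
Qed.

(** Absolute summability, expressed through a decomposition, because inner
    products come with one that is easier to bound than their absolute value
    (see [ell2_ip_summable]). *)
Definition summablef h :=
  exists p q, [/\ nnsummable p, nnsummable q & forall x, h x = p x - q x].

Definition rsum h : R :=
  nnsum (fun x => Num.max (h x) 0) - nnsum (fun x => Num.max (- h x) 0).

(** The sum does not depend on the decomposition: from [h = p - q] follows
    [h^+ + q = p + h^-], where all terms are nonnegative and summable. *)
Lemma rsumE h p q : nnsummable p -> nnsummable q ->
  (forall x, h x = p x - q x) -> rsum h = nnsum p - nnsum q.
Proof.
move=> ps qs e; have [[p0 _] [q0 _]] := (ps, qs).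
have s1 : nnsummable (fun x => Num.max (h x) 0).
  apply: nnsummable_le ps => x; rewrite le_max lexx orbT ge_max p0 andbT e /=.
  by have := q0 x; lra.
have s2 : nnsummable (fun x => Num.max (- h x) 0).
  apply: nnsummable_le qs => x; rewrite le_max lexx orbT ge_max q0 andbT e /=.
  by have := p0 x; lra.
apply/eqP; rewrite subr_eq addrAC eq_sym subr_eq -!nnsumD //; apply/eqP.
congr nnsum; apply/funext => x; rewrite e opprB.
have [|] := leP (p x - q x) 0; have [|] := leP (q x - p x) 0; lra.
Qed.

Lemma rsumD h h' : summablef h -> summablef h' ->
  rsum (fun x => h x + h' x) = rsum h + rsum h'.
Proof.
move=> [p [q [ps qs e]]] [p' [q' [ps' qs' e']]].
rewrite (rsumE ps qs e) (rsumE ps' qs' e').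
rewrite (@rsumE _ (fun x => p x + p' x) (fun x => q x + q' x));
  [|exact: nnsummableD..|by move=> x; rewrite e e' opprD addrACA].
by rewrite !nnsumD // opprD addrACA.
Qed.

Lemma rsumN h : rsum (fun x => - h x) = - rsum h.
Proof.
rewrite /rsum opprB; congr (_ - _); congr nnsum; apply/funext => x.
by rewrite opprK.
Qed.

Lemma rsumZ (a : R) h : summablef h -> rsum (fun x => a * h x) = a * rsum h.
Proof.
have pos b : 0 <= b -> summablef h -> rsum (fun x => b * h x) = b * rsum h.
  move=> b0 [p [q [ps qs e]]]; rewrite (rsumE ps qs e).
  have [ps' _] := nnsummableZ b0 ps; have [qs' _] := nnsummableZ b0 qs.
  rewrite (rsumE ps' qs'); last by move=> x; rewrite e mulrBr.
  by rewrite !nnsumZ // mulrBr.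
move=> hs; have [a0|a0] := leP 0 a; first exact: pos.
rewrite (_ : (fun x => a * h x) = (fun x => - (- a * h x))).
  by rewrite rsumN pos ?oppr_ge0 ?ltW // mulNr opprK.
by apply/funext => x; rewrite mulNr opprK.
Qed.

Lemma rsum_nonneg p : nnsummable p -> rsum p = nnsum p.
Proof.
move=> ps; have z : nnsummable (fun _ : X => 0 : R).
  by split=> //; rewrite esum1 ?ltry.
rewrite (rsumE ps z); last by move=> x; rewrite subr0.
by rewrite /nnsum [X in _ - fine X]esum1 // subr0.
Qed.

End NonnegativeSums.

Section ComplexSquares.
Local Open Scope complex_scope.
Variable R : realType.
Implicit Types z w u : R[i].

Definition csq z : R := complex.Re z ^+ 2 + complex.Im z ^+ 2.
Definition cre z w : R :=
  complex.Re z * complex.Re w + complex.Im z * complex.Im w.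

Lemma csq_ge0 z : 0 <= csq z.
Proof. by rewrite addr_ge0 ?sqr_ge0. Qed.

Lemma csq_eq0 z : csq z = 0 -> z = 0.
Proof.
case: z => a b /eqP; rewrite /csq /= paddr_eq0 ?sqr_ge0 // !sqrf_eq0.
by case/andP=> /eqP -> /eqP ->.
Qed.

Lemma csqM z w : csq (z * w) = csq z * csq w.
Proof. by case: z w => a b [c d]; rewrite /csq /=; ring. Qed.

Lemma csqD_le z w : csq (z + w) <= 2 * csq z + 2 * csq w.
Proof.
case: z w => a b [c d]; rewrite /csq /= -subr_ge0.
rewrite [X in 0 <= X](_ : _ = (a - c) ^+ 2 + (b - d) ^+ 2); last by ring.
by rewrite addr_ge0 ?sqr_ge0.
Qed.

Lemma creC z w : cre z w = cre w z.
Proof. by rewrite /cre; ring. Qed.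

Lemma creDl z w u : cre (z + w) u = cre z u + cre w u.
Proof. by case: z w u => [a b] [c d] [e f]; rewrite /cre /=; ring. Qed.

Lemma creZr (a : R) z w : cre (a%:C * z) w = a * cre z w.
Proof. by case: z w => [b c] [d e]; rewrite /cre /=; ring. Qed.

Lemma creJ u z w : cre (u * z) w = cre z (u^* * w).
Proof. by case: u z w => [a f] [b c] [d e]; rewrite /cre /=; ring. Qed.

(** This exhibits an inner product as a difference of two nonnegative families
    which are summable when both functions are square-summable. *)
Lemma cre_polar z w : cre z w = 2^-1 * csq (z + w) - 2^-1 * (csq z + csq w).
Proof. by case: z w => [b c] [d e]; rewrite /cre /csq /=; field. Qed.

End ComplexSquares.

Section Ell2.
Local Open Scope complex_scope.
Variables (R : realType) (X : choiceType).

Definition square_summable : pred (X -> R[i]) :=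
  fun f => `[< nnsummable (fun x => csq (f x)) >].

Lemma square_summable_submod : submod_closed square_summable.
Proof.
split.
  apply/asboolP; split=> [x|]; first exact: csq_ge0.
  by rewrite esum1 ?ltry // => x _; rewrite /csq /= expr0n addr0.
move=> z f g /asboolP fs /asboolP gs; apply/asboolP.
have [s1 _] := @nnsummableZ _ _ _ (2 * csq z) (mulr_ge0 (ler0n R 2) (csq_ge0 z)) fs.
have [s2 _] := @nnsummableZ _ _ _ 2 (ler0n R 2) gs.
apply: nnsummable_le (nnsummableD s1 s2) => x; rewrite csq_ge0 /=.
by apply: le_trans (csqD_le _ _) _; rewrite csqM mulrA.
Qed.

Record ell2 := Ell2 { ell2_fun :> X -> R[i]; ell2_prop : square_summable ell2_fun }.

HB.instance Definition _ := [isSub for ell2_fun].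
HB.instance Definition _ := [Choice of ell2 by <:].
HB.instance Definition _ := GRing.isSubmodClosed.Build R[i] (X -> R[i])
  square_summable square_summable_submod.
HB.instance Definition _ := [SubChoice_isSubLmodule of ell2 by <:].

Implicit Types f g h : ell2.

Lemma ell2_eq f g : f =1 g -> f = g.
Proof. by move=> e; apply/val_inj/funext. Qed.

Lemma ell2D f g x : (f + g) x = f x + g x.
Proof. by []. Qed.

Lemma ell2B f g x : (f - g) x = f x - g x.
Proof. by []. Qed.

Lemma ell2Z z f x : (z *: f) x = z * f x.
Proof. by []. Qed.

Lemma ell2P f : nnsummable (fun x => csq (f x)).
Proof. exact/asboolP/(valP f). Qed.

Definition ell2_ip f g : R := rsum (fun x => cre (f x) (g x)).

Lemma ell2_ip_summable f g : summablef (fun x => cre (f x) (g x)).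
Proof.
have h0 : (0 : R) <= 2^-1 by [].
exists (fun x => 2^-1 * csq (f x + g x)), (fun x => 2^-1 * (csq (f x) + csq (g x))).
split; last by move=> x; rewrite cre_polar.
  exact: (nnsummableZ h0 (ell2P (f + g))).1.
exact: (nnsummableZ h0 (nnsummableD (ell2P f) (ell2P g))).1.
Qed.

Lemma ell2_ipC f g : ell2_ip f g = ell2_ip g f.
Proof. by congr rsum; apply/funext => x; rewrite creC. Qed.

Lemma ell2_ipDl f g h : ell2_ip (f + g) h = ell2_ip f h + ell2_ip g h.
Proof.
rewrite -rsumD; [|exact: ell2_ip_summable..].
by congr rsum; apply/funext => x; rewrite ell2D creDl.
Qed.

Lemma ell2_ipZr (a : R) f g : ell2_ip (a%:C *: f) g = a * ell2_ip f g.
Proof.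
rewrite -rsumZ; last exact: ell2_ip_summable.
by congr rsum; apply/funext => x; rewrite ell2Z creZr.
Qed.

Lemma ell2_ipZ z f g : ell2_ip (z *: f) g = ell2_ip f (z^* *: g).
Proof. by congr rsum; apply/funext => x; rewrite !ell2Z creJ. Qed.

Lemma ell2_ipE f : ell2_ip f f = nnsum (fun x => csq (f x)).
Proof. exact/rsum_nonneg/ell2P. Qed.

Lemma ell2_ip_ge0 f : 0 <= ell2_ip f f.
Proof. by rewrite ell2_ipE nnsum_ge0 // => x; exact: csq_ge0. Qed.

Lemma ell2_point f x : csq (f x) <= ell2_ip f f.
Proof.
rewrite ell2_ipE; apply: le_trans (nnsum_finite [fset x]%fset (ell2P f)).
by rewrite big_seq_fset1.
Qed.

Definition ell2_norm f : R[i] := (Num.sqrt (ell2_ip f f))%:C.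

Lemma ell2_norm_sq f : (ell2_ip f f)%:C = ell2_norm f ^+ 2.
Proof. by rewrite -rmorphXn /= sqr_sqrtr // ell2_ip_ge0. Qed.

(** Minkowski's inequality; the discriminant of [t |-> |f + t g|^2] gives
    Cauchy-Schwarz. *)
Lemma ell2_normD f g : ell2_norm (f + g) <= ell2_norm f + ell2_norm g.
Proof.
rewrite -rmorphD lecR.
set a := Num.sqrt (ell2_ip f f); set b := Num.sqrt (ell2_ip g g).
have a0 : 0 <= a by exact: sqrtr_ge0.
have b0 : 0 <= b by exact: sqrtr_ge0.
rewrite -(@ler_pXn2r _ 2) ?nnegrE ?addr_ge0 ?sqrtr_ge0 //.
rewrite [leLHS]sqr_sqrtr ?ell2_ip_ge0 //.
have expand (t : R) : ell2_ip (f + t%:C *: g) (f + t%:C *: g) =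
    a ^+ 2 + 2 * t * ell2_ip f g + t ^+ 2 * b ^+ 2.
  rewrite !sqr_sqrtr ?ell2_ip_ge0 //.
  rewrite ell2_ipDl ell2_ipZr ![ell2_ip _ (f + _)]ell2_ipC !ell2_ipDl !ell2_ipZr.
  by rewrite [ell2_ip g f]ell2_ipC; ring.
have cs : ell2_ip f g ^+ 2 <= a ^+ 2 * b ^+ 2.
  by apply: psd_discriminant; rewrite ?sqr_ge0 // => t; rewrite -expand ell2_ip_ge0.
have := expand 1; rewrite scale1r => ->.
have ab : ell2_ip f g <= a * b.
  apply: le_trans (ler_norm _) _; rewrite -(@ler_pXn2r _ 2) ?nnegrE ?mulr_ge0 //.
  by rewrite real_normK ?num_real // exprMn.
lra.
Qed.

Lemma ell2_normZ z f : ell2_norm (z *: f) = `|z| * ell2_norm f.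
Proof.
rewrite normc_def -rmorphM; congr (_ %:C).
rewrite -[_ + _]/(csq z) -sqrtrM ?csq_ge0 //; congr Num.sqrt.
rewrite !ell2_ipE -nnsumZ ?csq_ge0 //; last exact: ell2P.
by congr nnsum; apply/funext => x; rewrite ell2Z csqM.
Qed.

Lemma ell2_norm_eq0 f : ell2_norm f = 0 -> f = 0.
Proof.
move=> /complexI/eqP; rewrite sqrtr_eq0 => f0; apply: ell2_eq => x.
apply/csq_eq0/eqP; rewrite eq_le csq_ge0 andbT.
exact: le_trans (ell2_point f x) f0.
Qed.

HB.instance Definition _ := Lmodule_isNormed.Build R[i] ell2
  ell2_normD ell2_normZ ell2_norm_eq0.

Lemma ell2_ball f g (e : R) : 0 < e -> ball f e%:C g ->
  ell2_ip (f - g) (f - g) <= e ^+ 2.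
Proof.
move=> e0; rewrite -ball_normE /= => fg.
rewrite -lecR ell2_norm_sq rmorphXn.
by apply: lerXn2r; rewrite ?nnegrE ?ler0c ?(ltW e0) // ltW.
Qed.

Lemma ell2_dist_le f g (c : R) : 0 <= c -> ell2_ip (f - g) (f - g) <= c ^+ 2 ->
  `|f - g| <= c%:C.
Proof.
move=> c0; rewrite -lecR ell2_norm_sq rmorphXn /= => h.
by rewrite -(@ler_pXn2r _ 2) ?nnegrE ?ler0c.
Qed.

Lemma ell2_ball_coord f g (e : R) x : 0 < e -> ball f e%:C g ->
  `|complex.Re (f x) - complex.Re (g x)| <= e /\
  `|complex.Im (f x) - complex.Im (g x)| <= e.
Proof.
move=> e0 /(ell2_ball e0) fg; have := le_trans (ell2_point (f - g) x) fg.
have e0' := ltW e0; rewrite ell2B.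
case: (f x) (g x) => a b [c d]; rewrite /csq /= => h.
have ac := sqr_ge0 (a - c); have bd := sqr_ge0 (b - d).
split; rewrite -(@ler_pXn2r _ 2) ?nnegrE // real_normK ?num_real //; lra.
Qed.

(** Used with [u] the real or imaginary part of a coordinate. *)
Lemma cauchy_coord (F : set_system ell2) (u : ell2 -> R) : ProperFilter F ->
  cauchy F ->
  (forall f g (e : R), 0 < e -> ball f e%:C g -> `|u f - u g| <= e) ->
  cvg (u @ F).
Proof.
move=> FF cF hu; apply/cauchy_cvgP/cauchy_exP => e e0.
have e2 : 0 < (e / 2)%:C :> R[i] by rewrite ltcR divr_gt0.
have /cauchyP/(_ _ e2) [f Ff] := cF.
exists (u f); suff : \forall g \near F, ball (u f) e (u g) by [].
apply: filterS Ff => g fg; rewrite -ball_normE /=.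
apply: le_lt_trans (hu _ _ _ _ fg) _; first by rewrite divr_gt0.
by rewrite ltr_pdivrMr // ltr_pMr // ltr1n.
Qed.

Lemma cvg_big_sum (T : Type) (F : set_system T) {FF : Filter F} (s : seq X)
    (u : T -> X -> R) (l : X -> R) :
  (forall x, u t x @[t --> F] --> l x) ->
  \sum_(x <- s) u t x @[t --> F] --> \sum_(x <- s) l x.
Proof.
move=> ul; elim: s => [|x s IH].
  rewrite big_nil (_ : (fun t => _) = fun=> 0); first exact: cvg_cst.
  by apply/funext => t; rewrite big_nil.
rewrite big_cons (_ : (fun t => _) = fun t => u t x + \sum_(y <- s) u t y).
  by apply: cvgD; [exact: ul|exact: IH].
by apply/funext => t; rewrite big_cons.
Qed.

(** A Cauchy filter converges in each coordinate. The estimate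
    [sum_(x in A) |g x - g' x|^2 <= c] is preserved when [g'] goes to the
    coordinatewise limit [l], as [A] is finite; being uniform in [A], it bounds
    [|g - l|]. *)
Lemma ell2_complete (F : set_system ell2) : ProperFilter F -> cauchy F -> cvg F.
Proof.
move=> FF cF.
pose re x (f : ell2) := complex.Re (f x); pose im x (f : ell2) := complex.Im (f x).
have cre x : cvg (re x @ F).
  by apply: cauchy_coord => // f g e e0 /(ell2_ball_coord x e0)[].
have cim x : cvg (im x @ F).
  by apply: cauchy_coord => // f g e e0 /(ell2_ball_coord x e0)[].
pose l x : R[i] := (lim (re x @ F) +i* lim (im x @ F))%C.
have csq_cvg (f : ell2) x : (fun g : ell2 => csq (f x - g x)) @ F --> csq (f x - l x).
  rewrite (_ : (fun g : ell2 => csq (f x - g x)) = (fun g : ell2 =>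
    (re x f - re x g) ^+ 2 + (im x f - im x g) ^+ 2)).
    rewrite (_ : csq (f x - l x) = (re x f - lim (re x @ F)) ^+ 2 +
      (im x f - lim (im x @ F)) ^+ 2).
      apply: cvgD; rewrite expr2; apply: cvgM;
      by apply: cvgB; [exact: cvg_cst|].
    by rewrite /l /re /im; case: (f x).
  by apply/funext => g; rewrite /re /im /csq; case: (f x) (g x) => ? ? [].
have near (e : R) : 0 < e -> exists f : ell2, F (ball f e%:C) /\
    forall g, ball f e%:C g -> nnsummable (fun x => csq (g x - l x)) /\
      nnsum (fun x => csq (g x - l x)) <= (e + e) ^+ 2.
  move=> e0; have ec : 0 < e%:C :> R[i] by rewrite ltcR.
  have /cauchyP/(_ _ ec) [f Ff] := cF.
  exists f; split=> // g fg; apply: nnsum_bound => [x|A]; first exact: csq_ge0.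
  have lims := cvg_big_sum (s := enum_fset A) (csq_cvg g).
  apply: (cvgr_to_le (lims _)); apply: filterS Ff => h fh.
  have gh : ball g (e + e)%:C h.
    by rewrite rmorphD; apply: ball_triangle fh; exact: ball_sym.
  apply: le_trans (ell2_ball _ gh); last by rewrite addr_gt0.
  by rewrite ell2_ipE; exact: (nnsum_finite A (ell2P (g - h))).
have [//|f [Ff nf]] := near 1.
have lS : square_summable l.
  have [fl _] := nf f (ballxx _ ltr01).
  have : square_summable (f \- l) by apply/asboolP.
  have fS : square_summable f by exact: valP.
  move=> flS; have [s0 sL] := square_summable_submod.
  have := sL (-1) _ _ flS fS.
  rewrite (_ : _ + _ = l) //; apply/funext => x.
  by rewrite -[LHS]/(- 1 * (f x - l x) + f x) mulN1r opprB subrK.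
apply/cvg_ex; exists (Ell2 lS).
apply/cvgrPdist_le => e e0.
have eE : e = (complex.Re e)%:C by rewrite RRe_real ?gtr0_real.
have e2 : 0 < complex.Re e / 2 by rewrite divr_gt0 // -ltcR -eE.
have [g [Fg ng]] := near _ e2.
apply: filterS Fg => h gh; rewrite distrC eE; have [_ le] := ng _ gh.
apply: ell2_dist_le; first by rewrite ltW // -ltcR -eE.
by rewrite ell2_ipE [X in X ^+ 2]splitr.
Qed.

HB.instance Definition _ := Uniform_isComplete.Build ell2 ell2_complete.

Definition ell2_hilbert : hilbert R :=
  @Hilbert R ell2 ell2_ip ell2_ipC ell2_ipDl ell2_ipZr ell2_ipZ ell2_norm_sq.

End Ell2.

(** * Partial isometries induced by partial bijections *)

Section PartialBijections.
Local Open Scope complex_scope.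
Variables (R : realType) (X : choiceType).

(** [g] and [h] are mutually inverse bijections between the subsets of [X] on
    which they are defined. *)
Definition partial_inverse (g h : X -> option X) :=
  forall x y, g x = Some y <-> h y = Some x.

Definition pull (g : X -> option X) (f : X -> R[i]) x : R[i] :=
  if g x is Some y then f y else 0.

Lemma partial_inverseC g h : partial_inverse g h -> partial_inverse h g.
Proof. by move=> gh x y; split=> /gh. Qed.

(** Both sides sum [a] over the graph of the partial bijection. *)
Lemma esum_pull g h (a : X -> X -> \bar R) : partial_inverse g h ->
  (\esum_(x in [set: X]) (if g x is Some y then a y x else 0) =
   \esum_(y in [set: X]) (if h y is Some x then a y x else 0))%E.
Proof.
move=> gh; pose D := [set x | isSome (g x)]; pose E := [set y | isSome (h y)].
have cond (k : X -> option X) (b : X -> X -> \bar R) :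
    (\esum_(x in [set: X]) (if k x is Some y then b x y else 0) =
     \esum_(x in [set x | isSome (k x)]) (if k x is Some y then b x y else 0))%E.
  rewrite [RHS]esum_mkcond; apply: eq_esum => x _.
  case: ifPn => //; rewrite notin_setE /=.
  by case: (k x) => //= y /negP.
rewrite (cond g (fun x y => a y x)) (cond h) -/D -/E.
rewrite (@reindex_esum _ _ _ E D (fun y => odflt y (h y))).
  apply: eq_esum => y; rewrite /E /=; case hy : (h y) => [x|//] _ /=.
  by have /gh -> := hy.
split.
- move=> y; rewrite /E /D /=; case hy : (h y) => [x|//] _ /=.
  by have /gh -> := hy.
- move=> y y'; rewrite !inE /E /=.
  case hy : (h y) => [x|//] _; case hy' : (h y') => [x'|//] _ /= e; subst x'.
  by have /gh := hy; have /gh -> := hy' => -[].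
- move=> x; rewrite /D /E /=; case gx : (g x) => [y|//] _.
  by have /gh hy := gx; exists y; rewrite ?hy.
Qed.

Lemma rsum_pull g h (a : X -> X -> R) : partial_inverse g h ->
  rsum (fun x => if g x is Some y then a y x else 0) =
  rsum (fun y => if h y is Some x then a y x else 0).
Proof.
move=> gh.
have cut (k : X -> option X) (b : X -> X -> R) :
    nnsum (fun x => Num.max (if k x is Some y then b x y else 0) 0) =
    fine (\esum_(x in [set: X])
            (if k x is Some y then (Num.max (b x y) 0)%:E else 0))%E.
  congr fine; apply: eq_esum => x _; case: (k x) => // .
  by rewrite maxxx.
have cutN (k : X -> option X) (b : X -> X -> R) :
    nnsum (fun x => Num.max (- (if k x is Some y then b x y else 0)) 0) =
    nnsum (fun x => Num.max (if k x is Some y then - b x y else 0) 0).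
  congr nnsum; apply/funext => x; case: (k x) => //.
  by rewrite oppr0.
rewrite /rsum !cutN (cut g (fun x y => a y x)) (cut h).
rewrite (cut g (fun x y => - a y x)) (cut h (fun y x => - a y x)).
by rewrite (esum_pull (fun y x => (Num.max (a y x) 0)%:E) gh)
  (esum_pull (fun y x => (Num.max (- a y x) 0)%:E) gh).
Qed.

Section Operator.
Variables (g h : X -> option X).
Hypothesis gh : partial_inverse g h.
Local Notation H := (ell2_hilbert R X).

Lemma pull_bound (f : H) :
  nnsummable (fun x => csq (pull g f x)) /\
  nnsum (fun x => csq (pull g f x)) <= nnsum (fun x => csq (f x)).
Proof.
have e : (\esum_(x in [set: X]) (csq (pull g f x))%:E =
    \esum_(y in [set: X]) (if h y is Some x then (csq (f y))%:E else 0))%E.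
  rewrite -(esum_pull (fun y _ => (csq (f y))%:E) gh); apply: eq_esum => x _.
  by rewrite /pull; case: (g x) => //; rewrite /csq /= expr0n addr0.
have le : (\esum_(x in [set: X]) (csq (pull g f x))%:E <=
    \esum_(y in [set: X]) (csq (f y))%:E)%E.
  rewrite e; apply: le_esum => y _; case: (h y) => //.
  by rewrite lee_fin csq_ge0.
have s : nnsummable (fun x => csq (pull g f x)).
  split=> [x|]; first exact: csq_ge0.
  by apply: le_lt_trans le _; case: (ell2P f).
by split=> //; rewrite -lee_fin -!nnsumE //; exact: ell2P.
Qed.

Definition pull_ell2 (f : H) : H := Ell2 (asboolT (pull_bound f).1).

End Operator.

(** Both sides sum the real part of [f y * conj (f' x)] over the graph of the
    partial bijection. *)
Lemma pull_adjoint g h (gh : partial_inverse g h) (hg : partial_inverse h g) :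
  adjoint (pull_ell2 gh) (pull_ell2 hg).
Proof.
move=> f f'; rewrite /hip /= /ell2_ip /=.
rewrite (_ : (fun x => cre (pull g f x) (f' x)) =
  (fun x => if g x is Some y then cre (f y) (f' x) else 0)).
  rewrite (rsum_pull (fun y x => cre (f y) (f' x)) gh); congr rsum.
  apply/funext => y; rewrite /pull; case: (h y) => //.
  by rewrite /cre /= !mulr0 addr0.
apply/funext => x; rewrite /pull; case: (g x) => //.
by rewrite /cre /= !mul0r addr0.
Qed.

Lemma pull_boperator g h (gh : partial_inverse g h) :
  boperator (pull_ell2 gh : ell2_hilbert R X -> ell2_hilbert R X).
Proof.
split.
- move=> z f f'; apply: ell2_eq => x; rewrite [LHS]/= ell2D ell2Z /= /pull.
  by case: (g x) => //; rewrite mulr0 addr0.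
- exists 1 => // f; rewrite mul1r lecR ler_wsqrtr // !ell2_ipE.
  exact: (pull_bound gh f).2.
- exists (pull_ell2 (partial_inverseC gh)); exact: pull_adjoint.
Qed.

Definition pullop g h (gh : partial_inverse g h) : bop (ell2_hilbert R X) :=
  BOp (asboolT (pull_boperator gh)).

Lemma pullopE g h (gh : partial_inverse g h) f x :
  (pullop gh f : ell2 R X) x = pull g (f : ell2 R X) x.
Proof. by []. Qed.

Lemma pullop_adj g h (gh : partial_inverse g h) :
  badj (pullop gh) = pullop (partial_inverseC gh).
Proof. by apply: badj_eq; exact: pull_adjoint. Qed.

Lemma esum_single (x : X) (c : R) : 0 <= c ->
  (\esum_(y in [set: X]) ((x == y)%:R * c)%:E = c%:E)%E.
Proof.
move=> c0; transitivity (\esum_(y in [set x]) c%:E)%E; last by rewrite esum_set1.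
rewrite [RHS]esum_mkcond; apply: eq_esum => y _.
have [->|xy] := eqVneq x y; first by rewrite mem_set // mul1r.
by rewrite memNset ?mul0r // => yx; move: xy; rewrite yx eqxx.
Qed.

Definition delta_fun (x : X) : X -> R[i] := fun y => (x == y)%:R.

Lemma csq_delta x y : csq (delta_fun x y) = (x == y)%:R * 1.
Proof.
rewrite /delta_fun mulr1; case: (x == y); rewrite /csq /=.
  by rewrite expr1n expr0n addr0.
by rewrite expr0n addr0.
Qed.

Lemma delta_summable x : square_summable (delta_fun x).
Proof.
apply/asboolP; split=> [y|]; first exact: csq_ge0.
by under eq_esum do rewrite csq_delta; rewrite esum_single // ltry.
Qed.

Definition delta x : ell2 R X := Ell2 (delta_summable x).

Lemma delta_ip x y : ell2_ip (delta x) (delta y) = (x == y)%:R.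
Proof.
have [<-|xy] := eqVneq x y.
  rewrite ell2_ipE /nnsum; under eq_esum do rewrite csq_delta.
  by rewrite esum_single.
rewrite /ell2_ip (_ : (fun z => _) = (fun=> 0)).
  by rewrite /rsum oppr0 subrr.
apply/funext => z; rewrite /delta /= /delta_fun /cre.
have [<-|_] := eqVneq x z; last by rewrite /= !mul0r addr0.
by rewrite eq_sym (negPf xy) /= !mulr0 addr0.
Qed.

Lemma pullop_delta g h (gh : partial_inverse g h) x :
  pullop gh (delta x) = if h x is Some y then delta y else 0.
Proof.
apply: ell2_eq => y; rewrite pullopE /pull /= /delta_fun.
case gy : (g y) => [x'|].
  have hx' := (gh y x').1 gy.
  have [->|xx'] := eqVneq x x'; first by rewrite hx' /= /delta_fun eqxx.
  case hx : (h x) => [y'|] //=; rewrite /delta_fun.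
  have [e|//] := eqVneq y' y; subst y'.
  by move/gh: hx; rewrite gy => -[e]; rewrite e eqxx in xx'.
case hx : (h x) => [y'|] //=; rewrite /delta_fun.
have [e|//] := eqVneq y' y; subst y'.
by move/gh: hx; rewrite gy.
Qed.

Lemma ell2_ipDr (f g h : ell2 R X) : ell2_ip f (g + h) = ell2_ip f g + ell2_ip f h.
Proof. exact: (@hipDr _ (ell2_hilbert R X)). Qed.

Lemma ell2_ip0l (f : ell2 R X) : ell2_ip 0 f = 0.
Proof. exact: (@hip0l _ (ell2_hilbert R X)). Qed.

Lemma delta_ip_sum_ge0 x (xs : seq X) :
  0 <= ell2_ip (delta x) (\sum_(y <- xs) delta y).
Proof.
elim: xs => [|y xs IH].
  by rewrite big_nil ell2_ipC ell2_ip0l.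
by rewrite big_cons ell2_ipDr addr_ge0 //= delta_ip ler0n.
Qed.

(** Expanding the square, the diagonal terms contribute the length and the
    others are nonnegative. *)
Lemma delta_sum_size (xs : seq X) :
  (size xs)%:R <= ell2_ip (\sum_(x <- xs) delta x) (\sum_(x <- xs) delta x).
Proof.
elim: xs => [|x xs IH]; first by rewrite ell2_ip_ge0.
rewrite big_cons; set v := \sum_(y <- xs) _ in IH *.
rewrite ell2_ipDl !ell2_ipDr /= delta_ip eqxx.
rewrite (ell2_ipC v) -natr1.
have := delta_ip_sum_ge0 x xs; rewrite -/v -[true%:R]/(1 : R); lra.
Qed.

Lemma delta_sum_unit (xs : seq X) :
  ell2_ip (\sum_(x <- xs) delta x) (\sum_(x <- xs) delta x) = 1 ->
  exists x, xs = [:: x].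
Proof.
move=> e; have := delta_sum_size xs; rewrite e lern1.
case: xs e => [|x [|y xs]] //.
  rewrite big_nil ell2_ip0l => /eqP.
  by rewrite eq_sym oner_eq0.
by move=> _ _; exists x.
Qed.

Lemma delta_inj : injective delta.
Proof.
move=> x y e; have := delta_ip x y; rewrite e delta_ip eqxx.
by case: eqVneq => // _ /eqP; rewrite oner_eq0.
Qed.

End PartialBijections.

(** * Isometries in a unital C*-algebra *)

Section CstarBasics.
Local Open Scope complex_scope.
Variables (R : realType) (A : cstarAlg R).
Implicit Types a b c x y : A.

Lemma cmulDl a b c : cmul (a + b) c = cmul a c + cmul b c.
Proof. by have := cmul_linl 1 a b c; rewrite !scale1r. Qed.

Lemma cmulDr a b c : cmul a (b + c) = cmul a b + cmul a c.
Proof. by have := cmul_linr 1 a b c; rewrite !scale1r. Qed.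

Lemma cmul0l a : cmul 0 a = 0.
Proof. by apply: (addrI (cmul 0 a)); rewrite -cmulDl !addr0. Qed.

Lemma cmul0r a : cmul a 0 = 0.
Proof. by apply: (addrI (cmul a 0)); rewrite -cmulDr !addr0. Qed.

Lemma cmulZl z a b : cmul (z *: a) b = z *: cmul a b.
Proof. by rewrite -[z *: a]addr0 cmul_linl cmul0l addr0. Qed.

Lemma cmulZr z a b : cmul a (z *: b) = z *: cmul a b.
Proof. by rewrite -[z *: b]addr0 cmul_linr cmul0r addr0. Qed.

Lemma cmulNl a b : cmul (- a) b = - cmul a b.
Proof. by rewrite -scaleN1r cmulZl scaleN1r. Qed.

Lemma cmulNr a b : cmul a (- b) = - cmul a b.
Proof. by rewrite -scaleN1r cmulZr scaleN1r. Qed.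

Lemma cmulBl a b c : cmul (a - b) c = cmul a c - cmul b c.
Proof. by rewrite cmulDl cmulNl. Qed.

Lemma cmulBr a b c : cmul a (b - c) = cmul a b - cmul a c.
Proof. by rewrite cmulDr cmulNr. Qed.

Lemma cmul_suml (I : Type) (r : seq I) (P : pred I) (F : I -> A) a :
  cmul (\sum_(i <- r | P i) F i) a = \sum_(i <- r | P i) cmul (F i) a.
Proof.
by apply: (big_morph (fun b => cmul b a)) => [b c|]; rewrite ?cmulDl ?cmul0l.
Qed.

Lemma cmul_sumr (I : Type) (r : seq I) (P : pred I) (F : I -> A) a :
  cmul a (\sum_(i <- r | P i) F i) = \sum_(i <- r | P i) cmul a (F i).
Proof.
by apply: (big_morph (cmul a)) => [b c|]; rewrite ?cmulDr ?cmul0r.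
Qed.

Lemma cadjD a b : cadj (a + b) = cadj a + cadj b.
Proof. by have := cadj_lin 1 a b; rewrite rmorph1 !scale1r. Qed.

Lemma cadj0 : cadj (0 : A) = 0.
Proof. by apply: (addrI (cadj (0 : A))); rewrite -cadjD !addr0. Qed.

Lemma cadjZ z a : cadj (z *: a) = z^* *: cadj a.
Proof. by rewrite -[z *: a]addr0 cadj_lin cadj0 addr0. Qed.

Lemma cadjB a b : cadj (a - b) = cadj a - cadj b.
Proof. by rewrite cadjD -scaleN1r cadjZ rmorphN1 scaleN1r. Qed.

Lemma cadj_sum (I : Type) (r : seq I) (P : pred I) (F : I -> A) :
  cadj (\sum_(i <- r | P i) F i) = \sum_(i <- r | P i) cadj (F i).
Proof. by apply: (big_morph (@cadj R A)) => [b c|]; rewrite ?cadjD ?cadj0. Qed.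

Lemma cnorm_adj a : `|cadj a| = `|a|.
Proof.
have le b : `|b| <= `|cadj b|.
  have [->|b0] := eqVneq b 0; first by rewrite normr0.
  by rewrite -(@ler_pM2r _ `|b|) ?normr_gt0 // -expr2 -cnorm_cstar cnormM.
by apply/eqP; rewrite eq_le -{2}[a]cadjK !le.
Qed.

Lemma cadj_mul_eq0 a : cmul (cadj a) a = 0 -> a = 0.
Proof.
move=> a0; apply/eqP; rewrite -normr_eq0 -sqrf_eq0 -cnorm_cstar a0.
by rewrite normr0.
Qed.

Lemma unit_unique (e e' : A) : is_unit e -> is_unit e' -> e = e'.
Proof. by move=> /(_ e')[_ h] /(_ e)[h' _]; rewrite -h' h. Qed.

Section Unital.
Variable e : A.
Hypothesis e_unit : is_unit e.

Lemma cmul1l a : cmul e a = a. Proof. by case: (e_unit a). Qed.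
Lemma cmul1r a : cmul a e = a. Proof. by case: (e_unit a). Qed.

Lemma cadj1 : cadj e = e.
Proof.
apply: unit_unique (e_unit) => a; split; apply: (can_inj (@cadjK R A));
by rewrite cadjM cadjK ?cmul1l ?cmul1r.
Qed.

(** The norm of the unit is 1, or 0 when the algebra is trivial. *)
Lemma cnorm1_le : `|e| <= 1.
Proof.
have [->|e0] := eqVneq e 0; first by rewrite normr0.
by rewrite -(@ler_pM2r _ `|e|) ?normr_gt0 // mul1r -expr2 -cnorm_cstar cadj1 cmul1l.
Qed.

Lemma isometry_norm a : cmul (cadj a) a = e -> `|a| <= 1.
Proof.
move=> ae; rewrite -(@ler_pXn2r _ 2) ?nnegrE // expr1n -cnorm_cstar ae.
exact: cnorm1_le.
Qed.

Lemma projection_norm a : cadj a = a -> cmul a a = a -> `|a| <= 1.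
Proof.
move=> aa a2; have [->|a0] := eqVneq a 0; first by rewrite normr0.
by rewrite -(@ler_pM2r _ `|a|) ?normr_gt0 // mul1r -expr2 -cnorm_cstar aa a2.
Qed.

Lemma cnorm_mul_le1 a b : `|a| <= 1 -> `|b| <= 1 -> `|cmul a b| <= 1.
Proof.
move=> a1 b1; apply: le_trans (cnormM _ _) _.
by rewrite -[1]mulr1 ler_pM.
Qed.

Lemma cnorm_mean_le1 a b : `|a| <= 1 -> `|b| <= 1 -> `|2^-1 *: (a + b)| <= 1.
Proof.
move=> a1 b1; rewrite normrZ ger0_norm ?invr_ge0 // ler_pdivrMl // mulr1.
by apply: le_trans (ler_normD _ _) _; apply: lerD.
Qed.

Lemma half_twice (u : A) : (2^-1 : R[i]) *: (u + u) = u.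
Proof.
rewrite -{1 2}[u]scale1r -scalerDl scalerA -[1 + 1]/(2 : R[i]).
by rewrite mulVf ?scale1r // pnatr_eq0.
Qed.

(** The exponents matter modulo 4; with all of them allowed, multiplying [x] by
    [i] is a shift of [k]. *)
Definition four_contractions x := forall k, `|e + 'i%C ^+ k *: x| <= 1.

(** Squares of contractions are contractions, and here the quadratic terms
    cancel: this is how contractions of the form [e + x] are amplified. *)
Lemma mean_of_squares x y : cmul x x + cmul y y = 0 ->
  (2^-1 : R[i]) *: (cmul (e + x) (e + x) + cmul (e + y) (e + y)) = e + (x + y).
Proof.
move=> xy; have sq u : cmul (e + u) (e + u) = (e + (u + u)) + cmul u u.
  by rewrite cmulDl !cmulDr !cmul1l cmul1r !addrA.
rewrite !sq addrACA xy addr0 -[RHS]half_twice; congr (_ *: _).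
by rewrite addrACA [RHS]addrACA [x + x + _]addrACA.
Qed.

(** [e + i^k (1 + i) x] is the mean of the squares of [e + i^k x] and
    [e + i^(k+1) x]. *)
Lemma four_contractions_rotate x :
  four_contractions x -> four_contractions ((1 + 'i%C) *: x).
Proof.
move=> fx k; rewrite scalerA mulrDr mulr1 -exprSr scalerDl.
rewrite -mean_of_squares; first by apply: cnorm_mean_le1; exact: cnorm_mul_le1.
rewrite !cmulZl !cmulZr !scalerA -scalerDl exprSr mulrACA -expr2 -expr2 sqr_i.
by rewrite mulrN1 subrr scale0r.
Qed.

(** [(1 + i)^2 = 2 i], and [i] permutes the four directions. *)
Lemma four_contractions_double x : four_contractions x -> four_contractions (x + x).
Proof.
move=> /four_contractions_rotate/four_contractions_rotate fx k.
(* The exponent [k + 3] compensates the factor [i], since [i^4 = 1]. *)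
have := fx (k + 3)%N; rewrite !scalerA.
suff -> : 'i ^+ (k + 3) * (1 + 'i) * (1 + 'i) = 'i ^+ k * 2 :> R[i].
  by rewrite -scalerA scaler_nat mulr2n.
rewrite exprD -!mulrA; congr (_ * _).
transitivity ('i * 'i ^+ 2 * (1 + 'i ^+ 2) + 2 * ('i ^+ 2) ^+ 2 : R[i]).
  by ring.
by rewrite sqr_i; ring.
Qed.

(** The unit is an extreme point of the unit ball: all the [2^n x] are
    within distance 1 of [-e], hence bounded. *)
Lemma four_contractions_eq0 x : four_contractions x -> x = 0.
Proof.
move=> fx; apply/eqP; rewrite -normr_eq0; apply/negPn/negP => x0.
have fn n : four_contractions (x *+ (2 ^ n)).
  elim: n => [|n IH]; first by rewrite expn0.
  by rewrite expnS mul2n -addnn mulrnDr; exact: four_contractions_double.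
have bound n : `|x| *+ (2 ^ n) <= 2.
  rewrite -normrMn; have := fn n 0; rewrite expr0 scale1r => h.
  have -> : x *+ 2 ^ n = (e + x *+ 2 ^ n) - e by rewrite addrAC subrr add0r.
  by apply: le_trans (ler_normB _ _) _; apply: lerD => //; exact: cnorm1_le.
have [r rE] : exists r : R, `|x| = r%:C.
  by exists (complex.Re `|x|); rewrite RRe_real ?normr_real.
have r0 : 0 < r.
  have : 0 < `|x| by rewrite lt_def x0 normr_ge0.
  by rewrite rE ltcR.
pose n := Num.Def.truncn (2 / r).
have n_lt : 2 / r < n.+1%:R by rewrite truncnS_gt.
have := bound n.+1; rewrite rE -[r%:C *+ _]rmorphMn -[2]/(2%:R) -(rmorph_nat (real_complex R)) lecR.
rewrite leNgt => /negP; apply.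
rewrite -[r *+ _]mulr_natr [ltRHS]mulrC -ltr_pdivrMr //; apply: lt_le_trans n_lt _.
by rewrite ler_nat ltnW // ltn_expl.
Qed.

(** For self-adjoint [x] the two real directions suffice:
    [|e + i x|^2 = |e + x^2|] by the C*-identity, and [e + x^2] is the mean of
    [(e + x)^2] and [(e - x)^2]. *)
Lemma four_contractions_selfadjoint x : cadj x = x ->
  `|e + x| <= 1 -> `|e - x| <= 1 -> four_contractions x.
Proof.
move=> xx p m.
have sq : `|e + cmul x x| <= 1.
  have <- : (2^-1 : R[i]) *: (cmul (e + x) (e + x) + cmul (e - x) (e - x)) = e + cmul x x.
    have sq2 u : cmul (e + u) (e + u) = (e + cmul u u) + (u + u).
      by rewrite cmulDl !cmulDr !cmul1l cmul1r [u + cmul u u]addrC addrACA.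
    by rewrite !sq2 cmulNl cmulNr opprK addrACA -opprD subrr addr0 half_twice.
  by apply: cnorm_mean_le1; exact: cnorm_mul_le1.
have iC (s : R[i]) : s ^+ 2 = -1 -> (s^*)%R = - s -> `|e + s *: x| <= 1.
  move=> ss sC; rewrite -(@ler_pXn2r _ 2) ?nnegrE // expr1n -cnorm_cstar.
  rewrite cadjD cadjZ cadj1 xx sC cmulDl !cmulDr !cmul1l cmul1r.
  rewrite !cmulZl !cmulZr scalerA mulNr -expr2 ss opprK scale1r.
  by rewrite scaleNr addrA addrK.
have conj_i : ('i%C^*)%R = - 'i%C :> R[i].
  by apply/eqP; rewrite eq_complex /= oppr0 !eqxx.
elim/ltn_ind; case=> [|[|[|[|k]]]] IH.
- by rewrite expr0 scale1r.
- by rewrite expr1; apply: iC; [exact: sqr_i|exact: conj_i].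
- by rewrite sqr_i scaleN1r.
- rewrite exprSr sqr_i mulN1r; apply: iC; first by rewrite sqrrN sqr_i.
  by apply/eqP; rewrite eq_complex /= !oppr0 !eqxx.
- rewrite -addn4 exprD (exprM _ 2 2) sqr_i sqrrN expr1n mulr1.
  by apply: IH; rewrite -addn4 -addSnnS leq_addr.
Qed.

(** The condition [|e - c i| <= 1] stands for positivity. If the [c j] add up to
    0, then for [m] summands both [e - c i / m] and [e + c i / m] are means of
    contractions: for the second one, [c i] is minus the sum of the other
    [c j]. *)
Lemma no_cancellation (I : eqType) (s : seq I) (c : I -> A) :
  (forall i, i \in s -> cadj (c i) = c i /\ `|e - c i| <= 1) ->
  \sum_(i <- s) c i = 0 -> forall i, i \in s -> c i = 0.
Proof.
move=> hs sum0 i is_; have [ci ei] := hs i is_.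
pose t := rem i s; pose m : R[i] := 1 + (size t)%:R.
have m0 : 0 < m by rewrite ltr_wpDr.
have sumt : \sum_(j <- t) c j = - c i.
  move: sum0; rewrite (perm_big _ (perm_to_rem is_)) /= big_cons => /eqP.
  by rewrite addrC addr_eq0 => /eqP.
have size_le (f : I -> A) (u : A) : `|u| <= 1 ->
    (forall j, j \in t -> `|f j| <= 1) -> `|u + \sum_(j <- t) f j| <= m.
  move=> u1 hf; apply: le_trans (ler_normD _ _) _; apply: lerD => //.
  apply: le_trans (ler_norm_sum _ _ _) _; rewrite -sum1_size natr_sum.
  by rewrite [leLHS]big_seq [leRHS]big_seq; apply: ler_sum.
have scale (v w : A) : m *: v = w -> `|w| <= m -> `|v| <= 1.
  move=> <-; rewrite normrZ gtr0_norm // => h.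
  by rewrite -(ler_pM2l m0) mulr1.
have sum_e : \sum_(j <- t) e = (size t)%:R *: e :> A.
  by rewrite big_const_seq count_predT iter_addr addr0 scaler_nat.
pose x := m^-1 *: c i.
have mx : m *: x = c i by rewrite scalerA mulfV ?gt_eqF // scale1r.
suff x0 : x = 0 by rewrite -mx x0 scaler0.
apply/four_contractions_eq0/four_contractions_selfadjoint.
- rewrite cadjZ ci; congr (_ *: _).
  by rewrite fmorphV rmorphD rmorph1 rmorph_nat.
- apply: (scale _ (e + \sum_(j <- t) (e - c j))).
    rewrite sumrB sumt opprK sum_e scalerDr mx scalerDl scale1r.
    by rewrite !addrA.
  apply: size_le => [|j jt]; first exact: cnorm1_le.
  by apply: (hs j _).2; apply: mem_rem jt.
- apply: (scale _ ((e - c i) + \sum_(j <- t) e)).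
    by rewrite sum_e scalerBr mx scalerDl scale1r addrAC.
  by apply: size_le => // j _; exact: cnorm1_le.
Qed.

(** Compressing the sum of the range projections by [a i] gives [e], which is
    already the [i]-th term, so that the elements [y j * adj (y j)] with
    [y j = adj (a i) * a j] and [j <> i] add up to 0. *)
Lemma isometries_orthogonal (I : eqType) (s : seq I) (a : I -> A) :
  uniq s -> (forall i, i \in s -> cmul (cadj (a i)) (a i) = e) ->
  \sum_(i <- s) cmul (a i) (cadj (a i)) = e ->
  forall i j, i \in s -> j \in s -> i != j -> cmul (cadj (a i)) (a j) = 0.
Proof.
move=> us iso sum1 i j is_ js ij.
pose y k := cmul (cadj (a i)) (a k).
suff : cmul (y j) (cadj (y j)) = 0.
  by rewrite -{1}[y j]cadjK => /cadj_mul_eq0 /(congr1 (@cadj R A)); rewrite cadjK cadj0.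
have yE k : cmul (y k) (cadj (y k)) =
    cmul (cmul (cadj (a i)) (cmul (a k) (cadj (a k)))) (a i).
  by rewrite /y cadjM cadjK !cmulA.
apply: (@no_cancellation _ (rem i s) (fun k => cmul (y k) (cadj (y k)))).
- move=> k kt; have ks := mem_rem kt.
  split; first by rewrite cadjM cadjK.
  have -> : e - cmul (y k) (cadj (y k)) =
      cmul (cmul (cadj (a i)) (e - cmul (a k) (cadj (a k)))) (a i).
    by rewrite yE cmulBr cmulBl cmul1r iso.
  have ai : `|a i| <= 1 by apply: isometry_norm; exact: iso.
  apply: (cnorm_mul_le1 _ ai); apply: cnorm_mul_le1; first by rewrite cnorm_adj.
  have pp : cmul (cmul (a k) (cadj (a k))) (cmul (a k) (cadj (a k))) =
      cmul (a k) (cadj (a k)).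
    by rewrite cmulA -(cmulA (a k)) iso // cmul1r.
  apply: projection_norm; last by rewrite cmulBl !cmulBr !cmul1l cmul1r pp subrr subr0.
  by rewrite cadjB cadj1 cadjM cadjK.
- have := sum1; rewrite (perm_big _ (perm_to_rem is_)) /= big_cons => s1.
  under eq_bigr do rewrite yE.
  rewrite -cmul_suml -cmul_sumr.
  have -> : \sum_(k <- rem i s) cmul (a k) (cadj (a k)) =
      e - cmul (a i) (cadj (a i)) by rewrite -s1 addrAC subrr add0r.
  rewrite cmulBr cmulBl cmul1r iso // !cmulA iso // cmul1l iso //.
  by rewrite subrr.
- by rewrite mem_rem_uniq // inE eq_sym ij.
Qed.

End Unital.
End CstarBasics.

(** * Infinite paths and the regular representation *)

Section InfinitePaths.
Variables (k : nat) (L : kgraph k).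
Implicit Types (x y z w : ipath L) (mu nu : L) (p q m n : Nk k).

(** By unique factorisation an initial segment determines the shorter ones. *)
Lemma ip_agree z w p q : leNk p q -> ip z 0 q = ip w 0 q ->
  ip z 0 p = ip w 0 p /\ ip z p q = ip w p q.
Proof.
move=> pq e; apply: kg_inj.
- by rewrite ip_src ?le0Nk // ip_rng.
- by rewrite ip_src ?le0Nk // ip_rng.
- by rewrite -!ip_cmp ?le0Nk.
- by rewrite !ip_deg ?le0Nk.
Qed.

Lemma cyl_trunc x n : cyl (ip x 0 n) x.
Proof. by apply/cylE; rewrite ip_deg ?le0Nk // subNk0. Qed.

Lemma prefix_shift mu x : cyl mu x -> prefix mu (shift (deg mu) x) = x.
Proof. by move=> /cylE h; apply/esym/prefix_unique. Qed.

Lemma shift_shift m n x : shift m (shift n x) = shift (m + n) x.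
Proof.
by apply: ip_eq => p q pq; rewrite !shiftE ?leNk_add // !addrA.
Qed.

Lemma shift0 x : shift 0 x = x.
Proof. by apply: ip_eq => p q pq; rewrite shiftE // !addr0. Qed.

Lemma cyl_cmp mu nu x : src mu = rng nu ->
  cyl (cmp mu nu) x <-> cyl mu x /\ cyl nu (shift (deg mu) x).
Proof.
move=> mn; rewrite !cylE deg_cmp // shiftE ?le0Nk // add0r [deg nu + _]addrC.
have le : leNk (deg mu) (deg mu + deg nu) by exact: leNk_addr.
rewrite (@ip_cmp _ _ x 0 (deg mu)) ?le0Nk //; split=> [e|[-> ->]//].
have src_rng_x : src (ip x 0 (deg mu)) = rng (ip x (deg mu) (deg mu + deg nu)).
  by rewrite ip_src ?le0Nk // ip_rng.
have deg_x : deg (ip x 0 (deg mu)) = deg mu by rewrite ip_deg ?le0Nk // subNk0.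
exact: kg_inj src_rng_x mn e deg_x.
Qed.

End InfinitePaths.

Section SingleVertex.
Variables (R : realType) (k : nat) (L : kgraph k) (v : L).
Hypothesis only_v : paths L 0 = [set v].
Hypothesis rowfin : row_finite L.
Implicit Types (x y z w : ipath L) (mu nu : L) (p q m n : Nk k).

Lemma vertexE mu : deg mu = 0 -> mu = v.
Proof. by move=> d; have : paths L 0 mu by []; rewrite only_v. Qed.

Lemma deg_v : deg v = 0.
Proof. by have : [set v] v by []; rewrite -only_v. Qed.

Lemma src_v mu : src mu = v.
Proof. by apply: vertexE; exact: deg_src. Qed.

Lemma rng_v mu : rng mu = v.
Proof. by apply: vertexE; exact: deg_rng. Qed.

Lemma composable mu nu : src mu = rng nu.
Proof. by rewrite src_v rng_v. Qed.

Lemma ip_v x p : ip x p p = v.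
Proof. by apply: vertexE; rewrite ip_deg ?leNkk // subNkk. Qed.

Lemma src_ip mu x : src mu = ip x 0 0.
Proof. by rewrite src_v ip_v. Qed.

Lemma cyl_prefix mu x : cyl mu (prefix mu x).
Proof. by apply/cylE; case: (prefixP (src_ip mu x)). Qed.

Lemma shift_prefix mu x : shift (deg mu) (prefix mu x) = x.
Proof. by case: (prefixP (src_ip mu x)). Qed.

Lemma cyl_v x : cyl v x.
Proof. by apply/cylE; rewrite deg_v ip_v. Qed.

Definition pathlist n : seq L := enum_fset (fset_set (paths_from v n)).

Lemma pathlist_finite n : finite_set (paths_from v n).
Proof. by apply: rowfin; rewrite only_v. Qed.

Lemma mem_pathlist n mu : (mu \in pathlist n) = (deg mu == n).
Proof.
rewrite /pathlist -[mu \in _]/(mu \in fset_set _) in_fset_set; last first.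
  exact: pathlist_finite.
by apply/idP/eqP => [/set_mem[]//|d]; apply/mem_set; split=> //; exact: rng_v.
Qed.

Lemma uniq_pathlist n : uniq (pathlist n).
Proof. exact: fset_uniq. Qed.

(** The partial bijection [mu y |-> y] from [Z(mu)] onto the path space, with
    inverse [add_path mu]. *)
Definition drop_path mu x : option (ipath L) :=
  if `[< cyl mu x >] then Some (shift (deg mu) x) else None.

Definition add_path mu x : option (ipath L) := Some (prefix mu x).

Lemma drop_add mu : partial_inverse (drop_path mu) (add_path mu).
Proof.
move=> x y; rewrite /drop_path /add_path; split.
  by case: asboolP => // mux [<-]; rewrite prefix_shift.
by move=> [<-]; rewrite asboolT ?shift_prefix //; exact: cyl_prefix.
Qed.

Definition paths_hilbert := ell2_hilbert R (ipath L).
Definition paths_algebra := bop_cstarAlg paths_hilbert.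

(** Composing functions with [mu y |-> y] moves the basis vector of [y] to that
    of [mu y]. *)
Definition regular mu : paths_algebra := pullop R (drop_add mu).

Lemma regularE mu (f : ell2 R (ipath L)) x :
  ((regular mu : bop paths_hilbert) f : ell2 R (ipath L)) x =
  if `[< cyl mu x >] then f (shift (deg mu) x) else 0.
Proof. by rewrite pullopE /pull /drop_path; case: asboolP. Qed.

Lemma regular_adjE mu (f : ell2 R (ipath L)) x :
  ((cadj (regular mu) : bop paths_hilbert) f : ell2 R (ipath L)) x = f (prefix mu x).
Proof. by rewrite [cadj _]pullop_adj. Qed.

Lemma regular_v (f : ell2 R (ipath L)) : (regular v : bop paths_hilbert) f = f.
Proof.
by apply: ell2_eq => x; rewrite regularE asboolT ?deg_v ?shift0 //; exact: cyl_v.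
Qed.

Lemma regular_op_eq (S T : paths_algebra) :
  (forall (f : ell2 R (ipath L)) x,
    ((S : bop paths_hilbert) f : ell2 R (ipath L)) x =
    ((T : bop paths_hilbert) f : ell2 R (ipath L)) x) -> S = T.
Proof. by move=> e; apply: bop_eq => f; apply: ell2_eq => x; exact: e. Qed.

Lemma regular_isometry mu : cmul (cadj (regular mu)) (regular mu) = regular v.
Proof.
apply: regular_op_eq => f x; rewrite regular_v -[cmul _ _]/(bmul _ _) bmulE.
rewrite regular_adjE regularE asboolT ?shift_prefix //; exact: cyl_prefix.
Qed.

Lemma regular_projE mu (f : ell2 R (ipath L)) x :
  ((cmul (regular mu) (cadj (regular mu)) : bop paths_hilbert) f : ell2 R (ipath L)) x
  = if `[< cyl mu x >] then f x else 0.
Proof.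
rewrite -[cmul _ _]/(bmul _ _) bmulE regularE regular_adjE.
by case: asboolP => // mux; rewrite prefix_shift.
Qed.

Lemma regular_sumE (I : Type) (s : seq I) (T : I -> paths_algebra)
    (f : ell2 R (ipath L)) x :
  ((\sum_(i <- s) T i : bop paths_hilbert) f : ell2 R (ipath L)) x =
  \sum_(i <- s) ((T i : bop paths_hilbert) f : ell2 R (ipath L)) x.
Proof.
by elim: s => [|i s IH]; rewrite ?big_nil // !big_cons -IH.
Qed.

(** The relations hold pointwise; in the last one exactly one summand is nonzero
    at [x], that of the initial segment of [x] of degree [n]. *)
Lemma regular_ck : ck_family regular.
Proof.
have iso := regular_isometry.
have v1 : forall S, cmul S (regular v) = S.
  move=> S; apply: regular_op_eq => f x.
  by rewrite -[cmul _ _]/(bmul _ _) bmulE regular_v.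
split.
- by move=> mu; rewrite /is_partial_isometry -cmulA iso v1.
- split=> [w|w w'].
    rewrite only_v => ->; split; last exact: v1.
    apply: regular_op_eq => f x; rewrite regular_adjE regular_v.
    by rewrite -{1}(shift0 x) -deg_v prefix_shift //; exact: cyl_v.
  by rewrite only_v => -> ->.
- move=> mu nu mn; apply: regular_op_eq => f x.
  rewrite -[cmul _ _]/(bmul _ _) bmulE !regularE deg_cmp // [deg mu + _]addrC.
  have -> : `[< cyl (cmp mu nu) x >] =
      `[< cyl mu x >] && `[< cyl nu (shift (deg mu) x) >].
    apply/asboolP/andP => [/(cyl_cmp _ mn)[a b]|[/asboolP a /asboolP b]].
      by split; apply/asboolP.
    by apply/(cyl_cmp _ mn).
  by case: `[< cyl mu x >] => //=; rewrite shift_shift.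
- by move=> mu; rewrite iso src_v.
- move=> w n; rewrite only_v => ->.
  rewrite fsbig_finite; last exact: pathlist_finite.
  rewrite -/(pathlist n); apply: regular_op_eq => f x; rewrite regular_v.
  rewrite regular_sumE; under eq_bigr do rewrite regular_projE.
  have xn : ip x 0 n \in pathlist n by rewrite mem_pathlist ip_deg ?le0Nk // subNk0.
  rewrite (bigD1_seq _ xn (uniq_pathlist n)) /= asboolT; last exact: cyl_trunc.
  rewrite big_seq_cond big1 ?addr0 // => mu /andP[]; rewrite mem_pathlist => /eqP d.
  by case: asboolP => // /cylE; rewrite d => ->; rewrite eqxx.
Qed.

End SingleVertex.

(** * The group of unitaries *)

Section UnitOfGenerated.
Variables (R : realType) (A : cstarAlg R).

Lemma closed_fixed (T : A -> A) (c : R[i]) :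
  (forall a b, T (a - b) = T a - T b) -> (forall a, `|T a| <= c * `|a|) ->
  closed [set a | T a = a].
Proof.
move=> TB Tc.
have -> : [set a | T a = a] = (fun a => T a - a) @^-1` [set 0].
  apply/seteqP; split=> a /=; first by move->; rewrite subrr.
  by move/eqP; rewrite subr_eq0 => /eqP.
apply: preimage_closed; last first.
  exact/accessible_closed_set1/hausdorff_accessible/norm_hausdorff.
move=> a _; apply/cvgrPdist_le => e e0.
have c0 : 0 < `|c| + 1 by rewrite ltr_wpDl.
near=> b.
have -> : T a - a - (T b - b) = T (a - b) - (a - b).
  by rewrite TB !opprB addrACA [RHS]addrACA [- a - _]addrC.
apply: le_trans (ler_normB _ _) _.
apply: le_trans (_ : (`|c| + 1) * `|a - b| <= _).
  rewrite mulrDl mul1r lerD //; apply: le_trans (Tc _) _.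
  have [->|ab0] := eqVneq `|a - b| 0; first by rewrite !mulr0.
  have ab : 0 < `|a - b| by rewrite lt_def ab0 /=.
  rewrite ler_pM2r //; apply: real_ler_norm.
  have := le_trans (normr_ge0 _) (Tc (a - b)).
  by rewrite pmulr_lge0 // => /ger0_real.
rewrite -ler_pdivlMl // mulrC; near: b.
by apply: cvgr_dist_le; [exact: cvg_id|rewrite divr_gt0].
Unshelve. all: by end_near. Qed.

(** The elements on which [e] acts as a unit form a C*-subalgebra. *)
Lemma generated_unit (D : set A) (e : A) : generates D -> cadj e = e ->
  (forall d, D d -> cmul e d = d /\ cmul d e = d) -> is_unit e.
Proof.
move=> gen ee De.
pose S := [set a | cmul e a = a] `&` [set a | cmul a e = a].
suff ST : S = setT by move=> a; have : S a by rewrite ST.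
apply: gen; last by move=> d /De.
split.
- by split; rewrite /mkset ?cmul0l ?cmul0r.
- move=> z a b [ea ae] [eb be]; split; rewrite /mkset.
    by rewrite cmul_linr ea eb.
  by rewrite cmul_linl ae be.
- move=> a b [ea ae] [eb be]; split; rewrite /mkset.
    by rewrite cmulA ea.
  by rewrite -cmulA be.
- by move=> a [ea ae]; split; rewrite /mkset -{1}ee -cadjM ?ea ?ae.
- apply: closedI.
    by apply: (@closed_fixed _ `|e|) => [a b|a]; [exact: cmulBr|exact: cnormM].
  apply: (@closed_fixed _ `|e|) => [a b|a]; first exact: cmulBl.
  by rewrite mulrC; exact: cnormM.
Qed.

End UnitOfGenerated.

Section HTAlgebra.
Variables (R : realType) (k : nat) (L : kgraph k) (v : L).
Hypothesis only_v : paths L 0 = [set v].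
Hypothesis rowfin : row_finite L.
Variables (O : cstarAlg R) (s : L -> O).
Hypothesis ck : ck_family s.
Hypothesis gen : generates (range s).
Implicit Types (x y z w : ipath L) (mu nu la : L) (n : Nk k) (U V : O).

Local Notation e := (s v).
Local Notation composable := (composable only_v).

Lemma s_cmp mu nu : s (cmp mu nu) = cmul (s mu) (s nu).
Proof. by case: ck => _ _ h _ _; apply: h; exact: composable. Qed.

Lemma s_iso mu : cmul (cadj (s mu)) (s mu) = e.
Proof. by case: ck => _ _ _ h _; rewrite h (src_v only_v). Qed.

Lemma s_unit : is_unit e.
Proof.
apply: (generated_unit gen).
  case: ck => _ [h _] _ _ _; have [] // := h v.
  by rewrite only_v.
move=> _ [mu _ <-]; rewrite -!s_cmp; split; congr s.
  by rewrite -{1}(rng_v only_v mu) cmp_rng.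
by rewrite -{1}(src_v only_v mu) cmp_src.
Qed.

Lemma s_sum n : \sum_(mu <- pathlist v n) cmul (s mu) (cadj (s mu)) = e.
Proof.
case: ck => _ _ _ _ h; rewrite (h v n) ?only_v //.
by rewrite fsbig_finite //; exact: (pathlist_finite only_v rowfin).
Qed.

(** The paths of a given degree form a family of isometries whose range
    projections add up to the unit. *)
Lemma s_orth mu nu : deg mu = deg nu -> mu != nu ->
  cmul (cadj (s mu)) (s nu) = 0.
Proof.
move=> d mn.
apply: (isometries_orthogonal s_unit (uniq_pathlist v (deg nu)) (a := s)) => //.
- by move=> *; exact: s_iso.
- exact: s_sum.
- by rewrite (mem_pathlist only_v rowfin) d.
- by rewrite (mem_pathlist only_v rowfin).
Qed.

(** The linear part of membership in the group; unitarity is separate. *)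
Definition ht_span U := exists l, ht_sum s l U.

Lemma ht_span0 : ht_span 0.
Proof. by exists [::]; split=> //; rewrite big_nil. Qed.

Lemma ht_spanD U V : ht_span U -> ht_span V -> ht_span (U + V).
Proof.
move=> [l [hl ->]] [l' [hl' ->]]; exists (l ++ l'); split; last by rewrite big_cat.
by move=> ab _; rewrite !(src_v only_v).
Qed.

Lemma ht_span_sum (I : Type) (r : seq I) (F : I -> O) :
  (forall i, ht_span (F i)) -> ht_span (\sum_(i <- r) F i).
Proof. by move=> h; apply: big_ind => //; [exact: ht_span0|exact: ht_spanD]. Qed.

Lemma ht_span_pair mu nu : ht_span (cmul (s mu) (cadj (s nu))).
Proof.
exists [:: (mu, nu)]; split; last by rewrite big_seq1.
by move=> ab _; rewrite !(src_v only_v).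
Qed.

Lemma ht_span_sandwich mu nu U : ht_span U ->
  ht_span (cmul (cmul (s mu) U) (cadj (s nu))).
Proof.
move=> [l [_ ->]]; rewrite cmul_sumr cmul_suml; apply: ht_span_sum => -[a b] /=.
rewrite cmulA -cmulA -s_cmp -cadjM -s_cmp.
exact: ht_span_pair.
Qed.

Lemma ht_span_adj U : ht_span U -> ht_span (cadj U).
Proof.
move=> [l [_ ->]]; rewrite cadj_sum; apply: ht_span_sum => -[a b] /=.
by rewrite cadjM cadjK; exact: ht_span_pair.
Qed.

(** Let [la = a b] with [a] of the degree of [mu]; then either [a = mu], or the
    product vanishes by orthogonality. *)
Lemma s_adj_mul_ge mu la n : deg la = deg mu + n ->
  cmul (cadj (s mu)) (s la) = 0 \/ exists nu, cmul (cadj (s mu)) (s la) = s nu.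
Proof.
move=> d; have [[a b] [/= [-> da _ _] _]] := kg_fact d.
rewrite s_cmp cmulA; have [<-|ma] := eqVneq mu a.
  by right; exists b; rewrite s_iso (cmul1l s_unit).
by left; rewrite s_orth ?cmul0l.
Qed.

(** The unit inserted between the two factors is the sum over the paths of a
    degree that lies above both degrees, so that each factor simplifies. *)
Lemma ht_span_adj_mul mu nu : ht_span (cmul (cadj (s mu)) (s nu)).
Proof.
rewrite -[s nu](cmul1l s_unit) -(s_sum (deg mu + deg nu)) cmul_suml cmul_sumr.
rewrite big_seq; apply: big_ind => [||la]; [exact: ht_span0|exact: ht_spanD|].
rewrite (mem_pathlist only_v rowfin) => /eqP d.
rewrite -[cmul (cmul (s la) _) _]cmulA cmulA.
have -> : cmul (cadj (s la)) (s nu) = cadj (cmul (cadj (s nu)) (s la)).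
  by rewrite cadjM cadjK.
have [->|[a ->]] := s_adj_mul_ge d; first by rewrite cmul0l; exact: ht_span0.
rewrite addrC in d.
have [->|[b ->]] := s_adj_mul_ge d; first by rewrite cadj0 cmul0r; exact: ht_span0.
exact: ht_span_pair.
Qed.

Lemma ht_spanM U V : ht_span U -> ht_span V -> ht_span (cmul U V).
Proof.
move=> [l [_ ->]] [l' [_ ->]]; rewrite cmul_suml; apply: ht_span_sum => -[a b] /=.
rewrite cmul_sumr; apply: ht_span_sum => -[c d] /=.
rewrite -cmulA [cmul _ (cmul (s c) _)]cmulA cmulA.
by apply: ht_span_sandwich; exact: ht_span_adj_mul.
Qed.

Lemma unitaryP U : is_unitary U <-> cmul (cadj U) U = e /\ cmul U (cadj U) = e.
Proof.
split=> [[h h']|[h h']]; last by split; rewrite ?h ?h'; exact: s_unit.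
by split; apply: unit_unique => //; exact: s_unit.
Qed.

Lemma ht_groupP U :
  ht_group s U <-> [/\ cmul (cadj U) U = e, cmul U (cadj U) = e & ht_span U].
Proof. by split=> [[/unitaryP[]]|[h h' l]]; split=> //; exact/unitaryP. Qed.

Lemma ht_group_mul U V : ht_group s U -> ht_group s V -> ht_group s (cmul U V).
Proof.
move=> /ht_groupP[u1 u2 uS] /ht_groupP[v1 v2 vS]; apply/ht_groupP; split.
- by rewrite cadjM cmulA -[cmul (cmul _ _) U]cmulA u1 (cmul1r s_unit) v1.
- by rewrite cadjM cmulA -[cmul (cmul _ _) (cadj V)]cmulA v2 (cmul1r s_unit) u2.
- exact: ht_spanM.
Qed.

Lemma ht_group_adj U : ht_group s U -> ht_group s (cadj U).
Proof.
move=> /ht_groupP[u1 u2 uS]; apply/ht_groupP.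
by split; rewrite ?cadjK //; exact: ht_span_adj.
Qed.

Lemma ht_group_unit : ht_group s e.
Proof.
apply/ht_groupP; rewrite (cadj1 s_unit) (cmul1l s_unit); split=> //.
by exists [:: (v, v)]; split=> [ab _|]; rewrite ?(src_v only_v) //
  big_seq1 /= (cadj1 s_unit) (cmul1l s_unit).
Qed.

Lemma ht_identity : is_identity (ht_group s) (@cmul R O) e.
Proof.
split; first exact: ht_group_unit.
by move=> U _; rewrite (cmul1l s_unit) (cmul1r s_unit).
Qed.

Lemma ht_is_group : is_group (ht_group s) (@cmul R O).
Proof.
split; first exact: ht_group_mul; first by move=> *; exact: cmulA.
exists e; first exact: ht_identity.
move=> U hU; exists (cadj U); first exact: ht_group_adj.
by have [] := (ht_groupP U).1 hU.
Qed.

(** In terms of paths, the cylinders [Z(mu)] partition the path space. *)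
Definition frame (l : seq L) := \sum_(mu <- l) cmul (s mu) (cadj (s mu)) = e.

(** The orthogonality is between positions, as the two components of a list of
    pairs are matched by position. *)
Lemma frame_orth l : frame l -> forall i j, (i < size l)%N -> (j < size l)%N ->
  i != j -> cmul (cadj (s (nth v l i))) (s (nth v l j)) = 0.
Proof.
move=> fl i j il jl ij.
apply: (isometries_orthogonal s_unit (iota_uniq 0 (size l))
  (a := fun i => s (nth v l i))) => //; rewrite ?mem_iota //.
- by move=> *; exact: s_iso.
- by rewrite -fl [in RHS](big_nth v) /index_iota subn0.
Qed.

(** Orthogonality of the [s_b] leaves only the diagonal terms of [U U^*], which
    are the [s_a s_a^*]; for [U^* U] exchange the two components. *)
Lemma ht_unitary (l : seq (L * L)) : frame (unzip1 l) -> frame (unzip2 l) ->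
  ht_group s (\sum_(ab <- l) cmul (s ab.1) (cadj (s ab.2))).
Proof.
pose U (t : seq (L * L)) := \sum_(ab <- t) cmul (s ab.1) (cadj (s ab.2)).
have half t : frame (unzip1 t) -> frame (unzip2 t) -> cmul (U t) (cadj (U t)) = e.
  move=> f1 f2; rewrite -f1 /unzip1 big_map /U cadj_sum cmul_suml.
  rewrite [LHS](big_nth (v, v)) [RHS](big_nth (v, v)) [LHS]big_seq [RHS]big_seq.
  apply: eq_bigr => i; rewrite mem_index_iota /= => it.
  rewrite cmul_sumr (big_nth (v, v)) (bigD1_seq i) ?mem_index_iota ?iota_uniq //=.
  rewrite big_seq_cond big1 ?addr0 => [|j].
    by rewrite cadjM cadjK cmulA -[cmul (cmul _ _) (s _)]cmulA s_iso (cmul1r s_unit).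
  rewrite mem_index_iota /= => /andP[jt ji].
  rewrite cadjM cadjK cmulA -[cmul (cmul _ _) (s _)]cmulA.
  have := frame_orth f2 (i := i) (j := j); rewrite size_map => /(_ it jt).
  by rewrite !(nth_map (v, v)) // eq_sym ji => -> //; rewrite cmul0r cmul0l.
move=> f1 f2; apply/ht_groupP; split; last 1 first.
- by exists l; split=> // ab _; rewrite !(src_v only_v).
- pose l' := [seq (ab.2, ab.1) | ab <- l].
  have -> : \sum_(ab <- l) cmul (s ab.1) (cadj (s ab.2)) = cadj (U l').
    by rewrite /U cadj_sum big_map; apply: eq_bigr => ab _; rewrite cadjM cadjK.
  rewrite cadjK; apply: half; rewrite /unzip1 /unzip2 -map_comp //.
- exact: half.
Qed.

End HTAlgebra.

(** * The action on infinite paths *)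

Section PathTopology.
Variables (k : nat) (L : kgraph k).
Implicit Types (x y z w : ipath L) (mu nu : L) (n : Nk k).

Lemma cyl_open mu : open (cyl mu).
Proof.
exists [set cyl mu]; first by move=> _ ->; exists mu.
by rewrite bigcup_set1.
Qed.

Lemma nbhs_cyl x n : nbhs x (cyl (ip x 0 n)).
Proof. by apply: open_nbhs_nbhs; split; [exact: cyl_open|exact: cyl_trunc]. Qed.

Lemma nbhs_cylP x (N : set (ipath L)) : nbhs x N -> exists n, cyl (ip x 0 n) `<=` N.
Proof.
rewrite nbhsE => -[B [[D sub <-] [A DA Ax]] BN].
have [mu _ muA] := sub _ DA; subst A.
exists (deg mu); move/cylE: (Ax) => ->.
by move=> w cw; apply: BN; exists (cyl mu).
Qed.

Lemma cyl_truncE x w n : cyl (ip x 0 n) w <-> ip w 0 n = ip x 0 n.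
Proof. by rewrite cylE ip_deg ?le0Nk // subNk0. Qed.

End PathTopology.

Section BasisAction.
Variables (R : realType) (k : nat) (L : kgraph k) (v : L).
Hypothesis only_v : paths L 0 = [set v].
Hypothesis rowfin : row_finite L.
Variables (O : cstarAlg R) (s : L -> O).
Hypothesis ck : ck_family s.
Hypothesis gen : generates (range s).
Local Notation H := (paths_hilbert R L).
Local Notation B := (bop (paths_hilbert R L)).
Local Notation delta := (delta R).
Variable f : O -> paths_algebra R L.
Hypothesis f_hom : star_hom f.
Hypothesis fs : forall mu, f (s mu) = regular R only_v mu.
Implicit Types (x y z w : ipath L) (mu nu la : L) (n : Nk k) (U V : O).

(** Where the pairs of [l] send [x]; a list, because a priori [x] may lie in
    several of the cylinders, or in none. *)
Definition images (l : seq (L * L)) x : seq (ipath L) :=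
  [seq prefix ab.1 (shift (deg ab.2) x) | ab <- l & `[< cyl ab.2 x >]].

Lemma f_sum (I : Type) (r : seq I) (F : I -> O) :
  f (\sum_(i <- r) F i) = \sum_(i <- r) f (F i).
Proof.
have [lin _ _] := f_hom.
have fD a b : f (a + b) = f a + f b by have := lin 1 a b; rewrite !scale1r.
have f0 : f 0 = 0 by apply: (addrI (f 0)); rewrite -fD !addr0.
exact: (big_morph f fD f0).
Qed.

Lemma bop_sumE (I : Type) (r : seq I) (T : I -> B) (h : H) :
  (\sum_(i <- r) T i) h = \sum_(i <- r) T i h.
Proof. by elim: r => [|i r IH]; rewrite ?big_nil // !big_cons -IH. Qed.

Lemma pair_delta mu nu x :
  (cmul (regular R only_v mu) (cadj (regular R only_v nu)) : B) (delta x) =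
  if `[< cyl nu x >] then delta (prefix mu (shift (deg nu) x)) else 0.
Proof.
rewrite -[cmul _ _]/(bmul _ _) bmulE [cadj _]pullop_adj pullop_delta /drop_path.
case: asboolP => _; first by rewrite pullop_delta.
by apply: ell2_eq => y; rewrite pullopE /pull; case: drop_path.
Qed.

Lemma f_delta l U x : ht_sum s l U ->
  (f U : B) (delta x) = \sum_(y <- images l x) delta y.
Proof.
have [_ fM fA] := f_hom.
move=> [_ ->]; rewrite f_sum [LHS]bop_sumE /images big_map big_filter.
rewrite [RHS]big_mkcond; apply: eq_bigr => -[a b] _ /=.
by rewrite fM fA !fs pair_delta.
Qed.

Lemma f_unitary U : ht_group s U ->
  forall h : H, (badj (f U : B)) ((f U : B) h) = h.
Proof.
have [_ fM fA] := f_hom.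
move=> /(ht_groupP only_v ck gen)[uu _ _] h.
have := fM (cadj U) U; rewrite uu fA fs => /(congr1 (fun T : B => T h)).
by rewrite regular_v.
Qed.

(** [f U] is isometric, so the sum of the basis vectors of the images is a unit
    vector. *)
Lemma images_unit l U x : ht_group s U -> ht_sum s l U ->
  exists y, images l x = [:: y].
Proof.
move=> hU lU; apply: (@delta_sum_unit R); rewrite -(f_delta x lU).
rewrite -[ell2_ip _ _]/(@hip _ H _ _) badjP f_unitary //.
by rewrite [LHS]delta_ip eqxx.
Qed.

(** This does not mention any decomposition of [U], so that independence of the
    decomposition needs no separate argument. *)
Definition ht_map U x : ipath L :=
  xget x [set y | (f U : B) (delta x) = delta y].

Lemma ht_map_action : is_ht_action s ht_map.
Proof.
move=> U l hU lU ab abl y _.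
have [z zE] := images_unit (prefix ab.2 y) hU lU.
have : prefix ab.1 y \in images l (prefix ab.2 y).
  apply/mapP; exists ab; last by rewrite (shift_prefix only_v).
  by rewrite mem_filter abl asboolT //; exact: (cyl_prefix only_v).
rewrite zE inE => /eqP ->.
have fz : (f U : B) (delta (prefix ab.2 y)) = delta z.
  by rewrite (f_delta _ lU) zE big_seq1.
have fw : (f U : B) (delta (prefix ab.2 y)) = delta (ht_map U (prefix ab.2 y)).
  exact: (@xgetPex _ (prefix ab.2 y)
    [set w | (f U : B) (delta (prefix ab.2 y)) = delta w] (ex_intro _ z fz)).
by apply: (@delta_inj R); rewrite -fw -fz.
Qed.

Variable phi : O -> ipath L -> ipath L.
Hypothesis phi_ht : is_ht_action s phi.

Lemma phi_prefix l U ab x : ht_group s U -> ht_sum s l U -> ab \in l ->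
  cyl ab.2 x -> phi U x = prefix ab.1 (shift (deg ab.2) x).
Proof.
move=> hU lU abl cx; rewrite -(phi_ht hU lU abl); last first.
  by rewrite (src_v only_v) (ip_v only_v).
by rewrite prefix_shift.
Qed.

Lemma phi_piece l U x : ht_group s U -> ht_sum s l U ->
  exists2 ab, ab \in l & cyl ab.2 x.
Proof.
move=> hU lU; have [y yE] := images_unit x hU lU.
have : y \in images l x by rewrite yE inE.
by move=> /mapP[ab]; rewrite mem_filter => /andP[/asboolP c abl] _; exists ab.
Qed.

(** A map that follows the decompositions of [U] is the one given by the
    representation, whichever decomposition is used. *)
Lemma phi_delta U x : ht_group s U -> (f U : B) (delta x) = delta (phi U x).
Proof.
move=> hU; have [_ [l lU]] := hU.
have [ab abl cx] := phi_piece x hU lU.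
rewrite (phi_prefix hU lU abl cx) (f_delta x lU).
have [y yE] := images_unit x hU lU.
have : prefix ab.1 (shift (deg ab.2) x) \in images l x.
  by apply/mapP; exists ab => //; rewrite mem_filter abl asboolT.
by rewrite yE inE big_seq1 => /eqP ->.
Qed.

Lemma phi_mul U V x : ht_group s U -> ht_group s V ->
  phi (cmul U V) x = phi U (phi V x).
Proof.
move=> hU hV; apply: (@delta_inj R).
rewrite -!phi_delta //; last exact: (ht_group_mul only_v rowfin ck gen).
by have [_ fM _] := f_hom; rewrite fM -[cmul _ _]/(bmul _ _) bmulE.
Qed.

Lemma phi_unit x : phi (s v) x = x.
Proof.
apply: (@delta_inj R); rewrite -phi_delta; last exact: (ht_group_unit only_v ck gen).
by rewrite fs regular_v.
Qed.

Lemma phi_adjK U x : ht_group s U -> phi (cadj U) (phi U x) = x.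
Proof.
move=> hU; rewrite -phi_mul //; last exact: (ht_group_adj only_v ck gen).
by have [-> _ _] := (ht_groupP only_v ck gen U).1 hU; exact: phi_unit.
Qed.

(** On [Z(b)] the action replaces [b] by [a], so the first [m] steps of the image
    are determined by the first [d(b) + m] steps of the path. *)
Lemma phi_continuous U : ht_group s U -> continuous (phi U).
Proof.
move=> hU x; have [_ [l lU]] := hU; have [[a b] abl /= cx] := phi_piece x hU lU.
move=> N /nbhs_cylP[m mN].
apply: filterS (nbhs_cyl x (deg b + m)) => w /cyl_truncE e.
apply: mN; apply/cyl_truncE.
have le1 : leNk (deg b) (deg b + m) by exact: leNk_addr.
have cw : cyl b w.
  by have [e1 _] := ip_agree le1 e; apply/cylE; rewrite e1; exact/cylE.
rewrite (phi_prefix hU lU abl cx) (phi_prefix hU lU abl cw) /=.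
have e' : ip (shift (deg b) w) 0 m = ip (shift (deg b) x) 0 m.
  by rewrite !shiftE ?le0Nk // add0r addrC; case: (ip_agree le1 e).
set x' := shift _ x in e' *; set w' := shift _ w in e' *.
have step z : ip (prefix a z) 0 (m + deg a) = cmp a (ip z 0 m).
  have la : leNk (deg a) (m + deg a) by exact: leNk_addl.
  rewrite (ip_cmp _ (le0Nk _) la); have /cylE -> := cyl_prefix only_v a z.
  by have := shiftE (deg a) (prefix a z) (le0Nk m); rewrite (shift_prefix only_v) add0r => ->.
have le2 : leNk m (m + deg a) by exact: leNk_addr.
by case: (@ip_agree _ _ (prefix a w') (prefix a x') _ _ le2); rewrite ?step ?e'.
Qed.

Lemma phi_homeo U : ht_group s U -> is_homeomorphism (phi U).
Proof.
move=> hU; have hU' := ht_group_adj only_v ck gen hU.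
split; first exact: phi_continuous.
exists (phi (cadj U)); first exact: phi_continuous.
split=> x; first exact: phi_adjK.
by rewrite -{1}[U]cadjK phi_adjK.
Qed.

Lemma phi_action : is_action_by_homeo (ht_group s) (@cmul R O) phi.
Proof.
split; [exact: (ht_is_group only_v rowfin ck gen)|exact: phi_homeo| |].
- move=> i [hi ii] x.
  suff -> : i = s v by exact: phi_unit.
  have [h1 h2] := ii _ (ht_group_unit only_v ck gen).
  by rewrite -h1 (cmul1r (s_unit only_v ck gen)).
- by move=> *; exact: phi_mul.
Qed.

End BasisAction.

(** * Compactness, minimality and extreme proximality *)

Lemma ultra_finite_partition (T : Type) (F : set_system T) (I : eqType) (r : seq I)
    (u : T -> I) : UltraFilter F -> (forall t, u t \in r) ->
  exists i, F [set t | u t = i].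
Proof.
move=> FU ur; suff : F [set t | u t \in r] -> exists i, F [set t | u t = i].
  by apply; apply: filterS filterT => t _; exact: ur.
elim: r {ur} => [|i r IH] h.
  by have [t] := filter_ex h.
have [hi|hi] := in_ultra_setVsetC [set t | u t = i] FU; first by exists i.
apply: IH; apply: filterS (filterI h hi) => t [/=].
by rewrite inE => /orP[/eqP|].
Qed.

Section Dynamics.
Variables (R : realType) (k : nat) (L : kgraph k) (v : L).
Hypothesis only_v : paths L 0 = [set v].
Hypothesis rowfin : row_finite L.

(** Along an ultrafilter, each coordinate is eventually constant, as it takes
    finitely many values. The functor axioms involve finitely many coordinates
    at a time, so the limit inherits them from a single path. *)
Lemma ipath_compact : compact [set: ipath L].
Proof.
rewrite compact_ultra => F FU _.
have limit (a : Omega k) : exists mu : L, F [set x : ipath L | x a = mu].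
  apply: (@ultra_finite_partition _ _ _ (pathlist v (om_deg a))) => x.
  by rewrite (mem_pathlist only_v rowfin); case: (ip_functor x) => _ _ _ ->.
pose g a := projT1 (cid (limit a)).
have gP a : F [set x : ipath L | x a = g a] by exact: (projT2 (cid (limit a))).
have g_functor : kg_functor g.
  split.
  - move=> a; have [x [/= <- <-]] := filter_ex (filterI (gP a) (gP (rng a))).
    by case: (ip_functor x).
  - move=> a; have [x [/= <- <-]] := filter_ex (filterI (gP a) (gP (src a))).
    by case: (ip_functor x).
  - move=> a b ab.
    have [x [/= [<- <-] <-]] :=
      filter_ex (filterI (filterI (gP a) (gP b)) (gP (cmp a b))).
    by case: (ip_functor x) => _ _ ->.
  - move=> a; have [x /= <-] := filter_ex (gP a).
    by case: (ip_functor x).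
exists (IPath g_functor); split=> // N /nbhs_cylP[n nN].
apply: filterS (gP (om 0 n)) => x /= xE; apply: nN.
by apply/cyl_truncE.
Qed.

Variables (O : cstarAlg R) (s : L -> O).
Hypothesis ck : ck_family s.
Hypothesis gen : generates (range s).

Local Notation range_proj mu := (cmul (s mu) (cadj (s mu))).

Lemma range_proj_refine mu n :
  \sum_(la <- pathlist v n) range_proj (cmp mu la) = range_proj mu.
Proof.
under eq_bigr => la _ do
  rewrite (s_cmp only_v ck) cadjM cmulA -[cmul (cmul _ (s la)) _]cmulA.
rewrite -cmul_suml -cmul_sumr (s_sum only_v rowfin ck).
by rewrite (cmul1r (s_unit only_v ck gen)).
Qed.

(** In the partition by the paths of degree [n], one cylinder may be cut
    further. *)
Lemma frame_replace n mu m : deg mu = n ->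
  frame v s ([seq la <- pathlist v n | la != mu] ++
             [seq cmp mu la | la <- pathlist v m]).
Proof.
move=> d; rewrite /frame big_cat big_map /= range_proj_refine big_filter addrC.
rewrite -[RHS](s_sum only_v rowfin ck n) [RHS](bigD1_seq mu) ?uniq_pathlist //.
by rewrite (mem_pathlist only_v rowfin) d.
Qed.

Definition swap mu nu (la : L) := if la == mu then nu else if la == nu then mu else la.

Lemma swap_frame n mu nu : deg mu = n -> deg nu = n ->
  frame v s (map (swap mu nu) (pathlist v n)).
Proof.
move=> dm dn; rewrite /frame -[RHS](s_sum only_v rowfin ck n).
have swapK : involutive (swap mu nu).
  move=> la; rewrite /swap; have [->|lm] := eqVneq la mu.
    by rewrite eqxx; case: eqVneq.
  have [->|ln] := eqVneq la nu; first by rewrite eqxx.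
  by rewrite (negPf lm) (negPf ln).
apply: perm_big; apply: uniq_perm; rewrite ?uniq_pathlist //.
  by rewrite map_inj_uniq ?uniq_pathlist //; exact: inv_inj.
have deg_swap la : deg (swap mu nu la) == n = (deg la == n).
  rewrite /swap; have [->|lm] := eqVneq la mu; first by rewrite dm dn.
  by have [->|ln] := eqVneq la nu; first by rewrite dm dn.
move=> la; rewrite (mem_pathlist only_v rowfin); apply/mapP/idP.
  by move=> [la']; rewrite (mem_pathlist only_v rowfin) => h ->; rewrite deg_swap.
move=> h; exists (swap mu nu la); last by rewrite swapK.
by rewrite (mem_pathlist only_v rowfin) deg_swap.
Qed.

Variable f : O -> paths_algebra R L.
Hypothesis f_hom : star_hom f.
Hypothesis fs : forall mu, f (s mu) = regular R only_v mu.
Variable phi : O -> ipath L -> ipath L.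
Hypothesis phi_ht : is_ht_action s phi.

(** With [be] and [mu] the initial segments of degree [n] of [x] and of a point of
    the open set, the group element exchanging [be] and [mu] moves [x] into
    [Z(mu)]. *)
Lemma phi_minimal : minimal_action (ht_group s) phi.
Proof.
move=> x N [y Ny] openN.
have [|n nN] := @nbhs_cylP _ _ y N; first by apply: open_nbhs_nbhs.
pose mu := ip y 0 n; pose be := ip x 0 n.
have dm : deg mu = n by rewrite ip_deg ?le0Nk // subNk0.
have db : deg be = n by rewrite ip_deg ?le0Nk // subNk0.
pose l := [seq (swap be mu la, la) | la <- pathlist v n].
have hU : ht_group s (\sum_(ab <- l) cmul (s ab.1) (cadj (s ab.2))).
  apply: (ht_unitary only_v ck gen).
    by rewrite /unzip1 -map_comp; exact: swap_frame.
  by rewrite /unzip2 -map_comp map_id; exact: (s_sum only_v rowfin ck).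
set U := \sum_(ab <- l) _ in hU.
exists (phi U x); split; last by exists U.
apply: nN; rewrite -/mu.
have lU : ht_sum s l U by split=> // ab _; rewrite !(src_v only_v).
have bl : (mu, be) \in l.
  apply/mapP; exists be; first by rewrite (mem_pathlist only_v rowfin) db.
  by rewrite /swap eqxx.
rewrite (phi_prefix only_v phi_ht hU lU bl (cyl_trunc x n)).
exact: (cyl_prefix only_v).
Qed.

(** The group element maps [ga y] to [nu ga y] for [ga <> mu] of degree [m],
    [mu la y] to [la y] for [la <> nu] of degree [n], and [mu nu y] to [nu mu y].
    The sources partition the path space by [frame_replace], where [Z(mu)] is
    cut; so do the targets, where [Z(nu)] is cut. It maps the complement of
    [Z(mu)] into [Z(nu)], and any point may serve as the point to which the set
    is compressed. *)
Lemma phi_extremely_proximal : extremely_proximal (ht_group s) phi.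
Proof.
move=> C closedC [_ /existsNP[x0 /not_implyP[_ xC]]].
have [|m mC] := @nbhs_cylP _ _ x0 (~` C).
  by apply: open_nbhs_nbhs; split=> //; exact: closed_openC.
exists x0 => N /nbhs_cylP[n nN].
pose mu := ip x0 0 m; pose nu := ip x0 0 n.
have dm : deg mu = m by rewrite ip_deg ?le0Nk // subNk0.
have dn : deg nu = n by rewrite ip_deg ?le0Nk // subNk0.
pose l := [seq (cmp nu ga, ga) | ga <- pathlist v m & ga != mu] ++
  ([seq (la, cmp mu la) | la <- pathlist v n & la != nu] ++
   [:: (cmp nu mu, cmp mu nu)]).
have hU : ht_group s (\sum_(ab <- l) cmul (s ab.1) (cadj (s ab.2))).
  apply: (ht_unitary only_v ck gen).
  - have := frame_replace m dn; rewrite /frame => <-.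
    rewrite /l /unzip1 !map_cat -!map_comp !big_cat !big_map big_seq1 /=.
    rewrite addrCA; congr (_ + _).
    rewrite addrC [RHS](bigD1_seq mu) ?uniq_pathlist ?(mem_pathlist only_v rowfin) ?dm //=.
    by rewrite big_filter.
  - have := frame_replace n dm; rewrite /frame => <-.
    rewrite /l /unzip2 !map_cat -!map_comp !big_cat !big_map big_seq1 /=.
    congr (_ + _).
    rewrite addrC [RHS](bigD1_seq nu) ?uniq_pathlist ?(mem_pathlist only_v rowfin) ?dn //=.
    by rewrite big_filter.
set U := \sum_(ab <- l) _ in hU.
exists U => // _ [x Cx <-]; apply: nN.
have lU : ht_sum s l U by split=> // ab _; rewrite !(src_v only_v).
pose ga := ip x 0 m.
have gl : (cmp nu ga, ga) \in l.
  rewrite mem_cat; apply/orP; left; apply/mapP; exists ga => //.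
  rewrite mem_filter (mem_pathlist only_v rowfin) ip_deg ?le0Nk // subNk0 eqxx andbT.
  by apply/eqP => e; apply: (mC x) => //; rewrite -/mu -e; exact: cyl_trunc.
rewrite (phi_prefix only_v phi_ht hU lU gl (cyl_trunc x m)).
have := cyl_prefix only_v (cmp nu ga) (shift (deg ga) x).
by case/(cyl_cmp _ (composable only_v nu ga)).
Qed.

End Dynamics.

Theorem lemma5p6 (R : realType) (k : nat) (L : kgraph k)
    (OL : cstarAlg R) (s : L -> OL) :
  (0 < k)%N ->
  row_finite L -> source_free L -> single_vertex L -> aperiodic L ->
  universal_ck s ->
  (exists phi : OL -> ipath L -> ipath L, is_ht_action s phi) /\
  (forall phi : OL -> ipath L -> ipath L, is_ht_action s phi ->
     extreme_boundary_action (ht_group s) (@cmul R OL) phi).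
Proof.
move=> _ rowfin _ [v only_v] _ [ck gen univ].
have [f f_hom fs] := univ _ _ (regular_ck R only_v rowfin).
split; first by exists (ht_map f); exact: (ht_map_action ck gen f_hom fs).
move=> phi phi_ht; split.
- exact: (phi_action rowfin ck gen f_hom fs phi_ht).
- exact: ipath_compact only_v rowfin.
- exact: (phi_minimal only_v rowfin ck gen phi_ht).
- exact: (phi_extremely_proximal only_v rowfin ck gen phi_ht).
Qed.
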